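(* Let $N\ge1$ be an integer and $\phi\in(-\pi/2,\pi/2)$, and let $\Gamma=\{xe^{i\phi\,\mathrm{sgn}(x)}:x\in\mathbb{R}\}$, which consists of the two rays $\{re^{i\phi}:r\ge0\}$ and $\{re^{i(\pi-\phi)}:r\ge 0\}$ (symmetric with respect to the imaginary axis). (i) If $\Gamma\setminus\{0\}$ is contained in the union of the Stokes wedges $S_k$, then for every $\lambda\in\mathbb{C}$ each of the two half-line equations $$-e^{\mp 2i\phi}w''(x)-(ix)^{N+2}e^{\pm(N+2)i\phi}w(x)=\lambda w(x),\quad x\in\mathbb{R}_\pm,$$ is in the limit-point case: up to a constant multiple it has exactly one nonzero solution in $L^2(\mathbb{R}_+)$, resp. $L^2(\mathbb{R}_-)$. (ii) If $\Gamma$ lies on Stokes lines $L_k$, then for every $\lambda\in\mathbb{C}$ each of these equations is in the limit-circle case: all its solutions lie in $L^2(\mathbb{R}_+)$, resp. $L^2(\mathbb{R}_-)$.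
   Context: With $\theta_k=-\frac{N+2}{2N+8}\pi+\frac{2k}{N+4}\pi$, $k=0,\dots,N+3$, the Stokes lines are the rays $L_k=\{z\in\mathbb{C}:\arg z=\theta_k\}$ and the Stokes wedges are the open sectors $S_k=\{z\in\mathbb{C}:\theta_{k-1}<\arg z<\theta_k\}$ (arguments taken modulo $2\pi$). Here $\mathbb{R}_+=[0,\infty)$, $\mathbb{R}_-=(-\infty,0]$; solutions have $w,w'$ locally absolutely continuous. *)

(* Defs.v *)
From Stdlib Require Import Reals Lra ZArith.
Open Scope R_scope.

Definition Cx : Type := (R * R)%type.
Definition Cre (z : Cx) : R := fst z.
Definition Cim (z : Cx) : R := snd z.
Definition C0 : Cx := (0, 0).
Definition RtoC (x : R) : Cx := (x, 0).
Definition Ci : Cx := (0, 1).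
Definition Cadd (z w : Cx) : Cx := (fst z + fst w, snd z + snd w).
Definition Copp (z : Cx) : Cx := (- fst z, - snd z).
Definition Cmul (z w : Cx) : Cx :=
  (fst z * fst w - snd z * snd w, fst z * snd w + snd z * fst w).
Fixpoint Cpow (z : Cx) (n : nat) : Cx :=
  match n with O => (1, 0) | S m => Cmul z (Cpow z m) end.
Definition cis (t : R) : Cx := (cos t, sin t).
Definition Cnormsq (z : Cx) : R := fst z * fst z + snd z * snd z.
Definition Cmod (z : Cx) : R := sqrt (Cnormsq z).

Definition sgn (x : R) : R :=
  match Rlt_dec 0 x with
  | left _ => 1
  | right _ => match Rlt_dec x 0 with left _ => -1 | right _ => 0 end
  end.

Definition Gamma (phi : R) (z : Cx) : Prop :=
  exists x : R, z = Cmul (RtoC x) (cis (phi * sgn x)).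

Definition theta (N : nat) (t : R) : R :=
  - (INR N + 2) / (2 * INR N + 8) * PI + 2 * t / (INR N + 4) * PI.

Definition on_Stokes_line (N k : nat) (z : Cx) : Prop :=
  exists r : R, 0 <= r /\ z = Cmul (RtoC r) (cis (theta N (INR k))).

(* Stokes wedge S_k = { z : theta_{k-1} < arg z < theta_k } (arg mod 2pi);
   since the sector has opening < 2pi, this is: z = r e^{i a} with r > 0
   and theta_{k-1} < a < theta_k for some real a. *)
Definition in_Stokes_wedge (N k : nat) (z : Cx) : Prop :=
  exists r a : R, 0 < r /\ theta N (INR k - 1) < a < theta N (INR k) /\
    z = Cmul (RtoC r) (cis a).

Definition has_derivC (f f' : R -> Cx) (x : R) : Prop :=
  derivable_pt_lim (fun t => fst (f t)) x (fst (f' x)) /\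
  derivable_pt_lim (fun t => snd (f t)) x (snd (f' x)).

(* domains: open half-lines (the endpoint 0 is irrelevant for L^2) *)
Definition half (s : bool) (x : R) : Prop := if s then 0 < x else x < 0.

Definition sgnb (s : bool) : R := if s then 1 else -1.

Definition is_solution (N : nat) (phi : R) (lam : Cx) (s : bool) (w : R -> Cx) : Prop :=
  exists w1 w2 : R -> Cx,
    forall x, half s x ->
      has_derivC w w1 x /\ has_derivC w1 w2 x /\
      Cadd (Copp (Cmul (cis (- sgnb s * 2 * phi)) (w2 x)))
           (Copp (Cmul (Cmul (Cpow (Cmul Ci (RtoC x)) (N + 2))
                             (cis (sgnb s * (INR N + 2) * phi))) (w x)))
      = Cmul lam (w x).

(* square integrability on the half-line (for continuous w, equivalent to
   Lebesgue L^2): the integrals of |w|^2 over compact subintervals of the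
   open half-line are uniformly bounded. *)
Definition L2_half (s : bool) (w : R -> Cx) : Prop :=
  exists M : R, forall a b (pr : Riemann_integrable (fun t => Cnormsq (w t)) a b),
    half s a -> half s b -> a <= b -> RiemannInt pr <= M.

Definition limit_point (N : nat) (phi : R) (lam : Cx) (s : bool) : Prop :=
  exists w0 : R -> Cx,
    is_solution N phi lam s w0 /\ L2_half s w0 /\
    (exists x, half s x /\ w0 x <> C0) /\
    forall w, is_solution N phi lam s w -> L2_half s w ->
      exists c : Cx, forall x, half s x -> w x = Cmul c (w0 x).

Definition limit_circle (N : nat) (phi : R) (lam : Cx) (s : bool) : Prop :=
  forall w, is_solution N phi lam s w -> L2_half s w.

(* Main.v *)
(** In the variable [t = |x|] both half-line equations become [w'' = (om t^m + mu) w]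
with [m = N + 2] and [|om| = 1], and [om = -1] exactly when the ray lies on a Stokes line.

If [om = -1], the energy [t^m |w|^2 + |w'|^2] corrected by [(m/2) Re (w' w^* ) / t] grows
at most like [t^(m/2 + 1/4)], so that [|w|^2] is at most of order [t^(-5/4)].

If [om <> -1], there is a unit complex [b] with [Re b > 0] and [Re (b om) > 0], and the flux
[Re (b w' w^* )] of every solution is eventually increasing, with derivative at least
[del (|w|^2 + |w'|^2)].  A solution [v] of positive flux is not square integrable, whereas the
solutions [u + c v] vanishing at [t] converge, as [t] tends to infinity, to a solution whose
flux stays nonpositive; bounding the integral of the flux derivative makes it square
integrable. *)

From Coquelicot Require Import Coquelicot.
Require Import Defs.
From Stdlib Require Import Reals Lra Lia Arith Classical.
Open Scope R_scope.

(** The plain energy [t^m |w|^2 + |w'|^2] has derivative [m t^(m-1) |w|^2] up to the [mu] term. This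
    allows growth like [t^m] and would leave [|w|^2] merely bounded. The correction has leading
    derivative [(m/2) (|w'|^2 - t^m |w|^2) / t]. It replaces the potential part by the average of
    potential and kinetic parts and halves the exponent to [m/2]; the extra [1/4] absorbs the
    remaining errors. The resulting rate [t^(1/4 - m/2)] is integrable at infinity because [N >= 1]
    gives [m >= 3].

    In the limit-point case a large flux of [v] controls only the product [|v| |v'|], so a small
    [|v|] beside a large [|v'|] must be excluded. The flux derivative also dominates [|v'|^2], and
    playing this bound against the product forces the integral of [|v|^2] to grow at least linearly.

    Solutions are given on an open half-line only. Power series at [0] provide a basis of entire
    solutions, and constant Wronskians express every half-line solution in it, so integrability near
    [0] is automatic and only tails remain. *)

Definition Cone : Cx := (1, 0).
Definition Cconj (z : Cx) : Cx := (fst z, - snd z).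

Ltac cx := apply injective_projections;
  unfold Cadd, Cmul, Copp, Cconj, RtoC, C0, Cone in *; simpl in *.

Lemma Cx_ring_theory : ring_theory C0 Cone Cadd Cmul (fun z w => Cadd z (Copp w)) Copp eq.
Proof. split; intros; try reflexivity; cx; ring. Qed.

Add Ring Cx_ring : Cx_ring_theory.

Lemma Cnormsq_ge0 z : 0 <= Cnormsq z.
Proof. unfold Cnormsq; nra. Qed.

Lemma Cnormsq_mul z w : Cnormsq (Cmul z w) = Cnormsq z * Cnormsq w.
Proof. unfold Cnormsq, Cmul; simpl; ring. Qed.

Lemma Cnormsq_conj z : Cnormsq (Cconj z) = Cnormsq z.
Proof. unfold Cnormsq, Cconj; simpl; ring. Qed.

Lemma fst_sqr_le z : fst z * fst z <= Cnormsq z.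
Proof. unfold Cnormsq; nra. Qed.

Lemma snd_sqr_le z : snd z * snd z <= Cnormsq z.
Proof. unfold Cnormsq; nra. Qed.

Lemma Cnormsq_eq0 z : Cnormsq z = 0 -> z = C0.
Proof. unfold Cnormsq; intros; cx; nra. Qed.

Definition Cinv (z : Cx) : Cx := (fst z / Cnormsq z, - snd z / Cnormsq z).

Lemma Cmul_inv z : z <> C0 -> Cmul z (Cinv z) = Cone.
Proof.
  intros hz.
  assert (h : Cnormsq z <> 0) by (intros h; apply hz, Cnormsq_eq0, h).
  unfold Cinv, Cnormsq in *; cx; field; auto.
Qed.

(** * Calculus *)

Lemma is_derive_addR f g x df dg : is_derive f x df -> is_derive g x dg ->
  is_derive (fun t : R => f t + g t) x (df + dg).
Proof. intros; now apply (is_derive_plus f g). Qed.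

Lemma is_derive_mulR f g x df dg : is_derive f x df -> is_derive g x dg ->
  is_derive (fun t : R => f t * g t) x (df * g x + f x * dg).
Proof. intros; apply (is_derive_mult f g); auto; intros; apply Rmult_comm. Qed.

Lemma is_derive_oppR f x df : is_derive f x df -> is_derive (fun t : R => - f t) x (- df).
Proof. intros; now apply (is_derive_opp f). Qed.

Lemma is_derive_subR f g x df dg : is_derive f x df -> is_derive g x dg ->
  is_derive (fun t : R => f t - g t) x (df - dg).
Proof. intros; now apply (is_derive_minus f g). Qed.

Lemma is_derive_eqR (f : R -> R) (x d d' : R) :
  is_derive f x d -> d = d' -> is_derive f x d'.
Proof. now intros h <-. Qed.

Lemma is_derive_powR n x : is_derive (fun t => t ^ n) x (INR n * x ^ pred n).
Proof. apply is_derive_Reals, derivable_pt_lim_pow. Qed.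

Ltac derive_rules := repeat lazymatch goal with
  | |- is_derive (fun t => _ + _) _ _ => eapply is_derive_addR
  | |- is_derive (fun t => _ - _) _ _ => eapply is_derive_subR
  | |- is_derive (fun t => _ * _) _ _ => eapply is_derive_mulR
  | |- is_derive (fun t => - _) _ _ => eapply is_derive_oppR
  end.

Lemma nonneg_derive_le f df a b : a <= b ->
  (forall x, a <= x <= b -> is_derive f x (df x)) ->
  (forall x, a <= x <= b -> 0 <= df x) -> f a <= f b.
Proof.
  intros hab hd hp.
  assert (hmin := Rmin_left a b hab). assert (hmax := Rmax_right a b hab).
  destruct (MVT_gen f a b df) as [c [hc e]].
  - rewrite hmin, hmax; intros x hx; apply hd; lra.
  - rewrite hmin, hmax; intros x hx. apply derivable_continuous_pt.
    exists (df x). apply is_derive_Reals, hd, hx.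
  - rewrite hmin, hmax in hc. specialize (hp c hc). nra.
Qed.

Definition is_Cderive (f : R -> Cx) (x : R) (l : Cx) : Prop :=
  is_derive (fun t => fst (f t)) x (fst l) /\ is_derive (fun t => snd (f t)) x (snd l).

Lemma is_Cderive_add f g x df dg : is_Cderive f x df -> is_Cderive g x dg ->
  is_Cderive (fun t => Cadd (f t) (g t)) x (Cadd df dg).
Proof. intros [] []; split; simpl; now apply is_derive_addR. Qed.

Lemma is_Cderive_mul f g x df dg : is_Cderive f x df -> is_Cderive g x dg ->
  is_Cderive (fun t => Cmul (f t) (g t)) x (Cadd (Cmul df (g x)) (Cmul (f x) dg)).
Proof.
  intros [] []; split; simpl; (eapply is_derive_eqR;
    [derive_rules; eassumption | simpl; ring]).
Qed.

Lemma is_Cderive_opp f x df : is_Cderive f x df ->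
  is_Cderive (fun t => Copp (f t)) x (Copp df).
Proof. intros []; split; simpl; now apply is_derive_oppR. Qed.

Lemma is_Cderive_conj f x df : is_Cderive f x df ->
  is_Cderive (fun t => Cconj (f t)) x (Cconj df).
Proof. intros []; split; simpl; auto; now apply is_derive_oppR. Qed.

Lemma is_Cderive_const c x : is_Cderive (fun _ => c) x C0.
Proof. split; apply (is_derive_const (K := R_AbsRing) (V := R_NormedModule)). Qed.

Lemma is_Cderive_eq f x l l' : is_Cderive f x l -> l = l' -> is_Cderive f x l'.
Proof. now intros h <-. Qed.

Lemma is_Cderive_zero_const f a b :
  (forall t, Rmin a b <= t <= Rmax a b -> is_Cderive f t C0) -> f a = f b.
Proof.
  enough (H : forall a b, a < b ->
    (forall t, a <= t <= b -> is_Cderive f t C0) -> f a = f b).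
  { intros h. destruct (Rtotal_order a b) as [l | [-> | l]]; auto.
    - apply H; auto. intros; apply h. rewrite Rmin_left, Rmax_right; lra.
    - symmetry; apply H; auto. intros; apply h. rewrite Rmin_right, Rmax_left; lra. }
  clear; intros a b l h. apply injective_projections.
  - apply (eq_is_derive (fun t => fst (f t))); auto. intros; now apply h.
  - apply (eq_is_derive (fun t => snd (f t))); auto. intros; now apply h.
Qed.

Lemma is_derive_Cnormsq w w1 x : is_Cderive w x w1 ->
  is_derive (fun t => Cnormsq (w t)) x (2 * fst (Cmul w1 (Cconj (w x)))).
Proof.
  intros [h1 h2]. unfold Cnormsq. eapply is_derive_eqR.
  - derive_rules; eassumption.
  - simpl; ring.
Qed.

Lemma continuous_Cnormsq w w1 x : is_Cderive w x w1 ->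
  continuous (fun t => Cnormsq (w t)) x.
Proof.
  intros h. apply (ex_derive_continuous (K := R_AbsRing) (V := R_NormedModule)).
  eexists. apply (is_derive_Cnormsq _ _ _ h).
Qed.

Lemma antiderivative_exists (D : R -> Prop) (f : R -> R) (c : R) :
  (forall x y z, D x -> D z -> x <= y <= z -> D y) -> D c ->
  (forall x, D x -> locally x D) -> (forall x, D x -> continuous f x) ->
  exists F, forall x, D x -> is_derive F x (f x).
Proof.
  intros hconv hc hopen hf. exists (fun x => RInt f c x). intros x hx.
  apply is_derive_RInt with c; auto.
  apply filter_imp with (2 := hopen x hx). intros y hy.
  apply (RInt_correct f c y), (ex_RInt_continuous f c y). intros z hz. apply hf.
  unfold Rmin, Rmax in hz. destruct Rle_dec; eapply hconv; [| | apply hz | | | apply hz]; auto.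
Qed.

(** * Entire solutions of [w'' = (om t^m + mu) w] *)

Definition coef (m : nat) (om mu : Cx) (t : R) : Cx := Cadd (Cmul (RtoC (t ^ m)) om) mu.

Definition is_sol (m : nat) (om mu : Cx) (D : R -> Prop) (w w1 : R -> Cx) : Prop :=
  forall t, D t -> is_Cderive w t (w1 t) /\ is_Cderive w1 t (Cmul (coef m om mu t) (w t)).

Definition everywhere (_ : R) : Prop := True.
Definition posR (t : R) : Prop := 0 < t.

(** The power series recursion reaches back [m] places, with [m] a variable, so whole histories are
    iterated instead of tuples of fixed length. *)
Lemma course_of_values_recursion {A : Type} (Phi : nat -> (nat -> A) -> A) (a0 a1 : A) :
  (forall n f g, (forall k, (k <= n)%nat -> f k = g k) -> Phi n f = Phi n g) ->
  exists a, a 0%nat = a0 /\ a 1%nat = a1 /\ forall n, a (S (S n)) = Phi n a.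
Proof.
  intros hPhi.
  (* [hist n] is correct at indices up to [n + 1]; beyond them it keeps the default [a1]. The
     sequence is the diagonal. *)
  set (hist := fix hist n : nat -> A := match n with
    | O => fun k => match k with O => a0 | _ => a1 end
    | S n' => fun k => if Nat.eqb k (S (S n')) then Phi n' (hist n') else hist n' k
    end).
  assert (hS : forall n k, (k <= S n)%nat -> hist (S n) k = hist n k).
  { intros n k hk. simpl. destruct (Nat.eqb_spec k (S (S n))); auto; lia. }
  assert (hstab : forall d n k, (k <= S n)%nat -> hist (d + n)%nat k = hist n k).
  { induction d; intros n k hk; auto.
    change (S d + n)%nat with (S (d + n)). rewrite hS by lia. auto. }
  assert (hdiag : forall n k, (k <= S n)%nat -> hist n k = hist k k).
  { intros n k hk. destruct (le_lt_dec k n) as [l | l].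
    - replace n with ((n - k) + k)%nat by lia. apply hstab; lia.
    - replace k with (S n) by lia. symmetry. apply hS; lia. }
  exists (fun k => hist k k). split; [| split]; auto.
  intros n. rewrite <- (hdiag (S n) (S (S n))) by lia.
  simpl. rewrite Nat.eqb_refl. apply hPhi. intros k hk. apply hdiag; lia.
Qed.

Lemma eventually_dominated_bounded (c : nat -> R) (K : nat) :
  (forall n M, (K <= n)%nat -> (forall k, (k < n)%nat -> c k <= M) -> c n <= M) ->
  exists M, forall n, c n <= M.
Proof.
  intros h.
  assert (hK : exists M, forall k, (k < K)%nat -> c k <= M).
  { clear h; induction K as [| K [M hM]].
    - exists 0; lia.
    - exists (Rmax M (c K)). intros k hk. destruct (Nat.eq_dec k K) as [-> |].
      + apply Rmax_r.
      + eapply Rle_trans; [apply hM; lia | apply Rmax_l]. }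
  destruct hK as [M hM]. exists M. intros n.
  induction n as [n IH] using lt_wf_ind.
  destruct (le_lt_dec K n); auto.
Qed.

Lemma CV_radius_infinite a :
  (forall r, 0 < r -> exists M, forall n, Rabs (a n * r ^ n) <= M) ->
  forall x, Rbar_lt (Rabs x) (CV_radius a).
Proof.
  intros h x. destruct (CV_radius_bounded a) as [hub _].
  assert (hx := Rabs_pos x).
  apply Rbar_lt_le_trans with (Rabs x + 1); [simpl; lra |].
  apply hub, h. lra.
Qed.

(** Comparing coefficients of [t^n] in [w'' = (om t^m + mu) w] gives [(n+1) (n+2) a_(n+2) = mu a_n +
    om a_(n-m)], the last term being absent for [n < m]. *)
Definition series_step (m : nat) (om mu : Cx) (n : nat) (a : nat -> Cx) : Cx :=
  Cmul (RtoC (/ (INR (S n) * INR (S (S n)))))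
    (Cadd (Cmul mu (a n)) (Cmul om (if le_lt_dec m n then a (n - m)%nat else C0))).

Definition Cnorm1 (z : Cx) : R := Rabs (fst z) + Rabs (snd z).

Lemma Cnorm1_ge0 z : 0 <= Cnorm1 z.
Proof. unfold Cnorm1. assert (h := Rabs_pos (fst z)). assert (h' := Rabs_pos (snd z)). lra. Qed.

Lemma Cnorm1_add z w : Cnorm1 (Cadd z w) <= Cnorm1 z + Cnorm1 w.
Proof.
  unfold Cnorm1; simpl. assert (h := Rabs_triang (fst z) (fst w)).
  assert (h' := Rabs_triang (snd z) (snd w)). lra.
Qed.

Lemma Cnorm1_mul z w : Cnorm1 (Cmul z w) <= Cnorm1 z * Cnorm1 w.
Proof.
  unfold Cnorm1; simpl.
  assert (h := Rabs_triang (fst z * fst w) (- (snd z * snd w))).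
  assert (h' := Rabs_triang (fst z * snd w) (snd z * fst w)).
  rewrite Rabs_Ropp in h. rewrite !Rabs_mult in h, h'. unfold Rminus. nra.
Qed.

Lemma Cnorm1_RtoC_mul x z : Cnorm1 (Cmul (RtoC x) z) = Rabs x * Cnorm1 z.
Proof.
  unfold Cnorm1, RtoC; simpl.
  rewrite !Rmult_0_l, Rminus_0_r, Rplus_0_r, !Rabs_mult; ring.
Qed.

(** If the earlier terms [|a_k| r^k] are at most [M], the recursion bounds the term of index [n + 2]
    by [S0 M / ((n+1) (n+2))], and this is at most [M] once [n + 2 >= S0]. As [r] is arbitrary, the
    radius of convergence is infinite. *)
Lemma series_coef_bounded m om mu a r : 0 < r ->
  (forall n, a (S (S n)) = series_step m om mu n a) ->
  exists M, forall n, Cnorm1 (a n) * r ^ n <= M.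
Proof.
  intros hr ha.
  set (S0 := Cnorm1 mu * r ^ 2 + Cnorm1 om * r ^ (m + 2)).
  destruct (INR_unbounded S0) as [K hK].
  apply eventually_dominated_bounded with (S (S K)).
  intros n M hn hM. destruct n as [| [| n]]; try lia.
  assert (hM0 : 0 <= M).
  { eapply Rle_trans; [| apply (hM 0%nat); lia].
    simpl; rewrite Rmult_1_r; apply Cnorm1_ge0. }
  rewrite ha; unfold series_step. rewrite Cnorm1_RtoC_mul.
  assert (hi : 1 <= INR (S n)) by (rewrite S_INR; assert (h := pos_INR n); lra).
  assert (hj : S0 <= INR (S (S n))).
  { apply Rle_trans with (INR K); [lra | apply le_INR; lia]. }
  assert (hd : 0 < INR (S n) * INR (S (S n))) by (rewrite (S_INR (S n)); nra).
  rewrite Rabs_right by (apply Rle_ge, Rlt_le, Rinv_0_lt_compat, hd).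
  assert (hs : Cnorm1 (Cadd (Cmul mu (a n))
      (Cmul om (if le_lt_dec m n then a (n - m)%nat else C0))) * r ^ S (S n) <= S0 * M).
  { eapply Rle_trans.
    { apply Rmult_le_compat_r; [apply pow_le; lra |].
      eapply Rle_trans; [apply Cnorm1_add | apply Rplus_le_compat; apply Cnorm1_mul]. }
    assert (h1 : Cnorm1 (a n) * r ^ n <= M) by (apply hM; lia).
    assert (h2 : Cnorm1 (if le_lt_dec m n then a (n - m)%nat else C0) * r ^ n <= M * r ^ m).
    { destruct le_lt_dec as [l | l].
      - replace n with ((n - m) + m)%nat at 2 by lia. rewrite pow_add, <- Rmult_assoc.
        apply Rmult_le_compat_r; [apply pow_le; lra | apply hM; lia].
      - unfold Cnorm1, C0; simpl. rewrite Rabs_R0.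
        assert (h := pow_lt r m hr). nra. }
    unfold S0. rewrite pow_add. simpl pow.
    assert (g1 := Cnorm1_ge0 mu). assert (g2 := Cnorm1_ge0 om).
    set (y := Cnorm1 (if le_lt_dec m n then _ else _)) in *.
    assert (k1 : Cnorm1 mu * (r * r) * (Cnorm1 (a n) * r ^ n) <= Cnorm1 mu * (r * r) * M)
      by (apply Rmult_le_compat_l; nra).
    assert (k2 : Cnorm1 om * (r * r) * (y * r ^ n) <= Cnorm1 om * (r * r) * (M * r ^ m))
      by (apply Rmult_le_compat_l; nra).
    lra. }
  rewrite Rmult_assoc. apply Rmult_le_reg_l with (1 := hd).
  rewrite <- Rmult_assoc, Rinv_r, Rmult_1_l by lra.
  eapply Rle_trans; [apply hs |]. apply Rmult_le_compat_r; [exact hM0 |].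
  assert (hk := pos_INR (S (S n))). clear - hi hj hk. nra.
Qed.

Lemma entire_solution m om mu a0 a1 :
  exists w w1, is_sol m om mu everywhere w w1 /\ w 0 = a0 /\ w1 0 = a1.
Proof.
  destruct (course_of_values_recursion (series_step m om mu) a0 a1)
    as [a [h0 [h1 ha]]].
  { intros n f g h. unfold series_step. rewrite h by lia.
    destruct le_lt_dec; auto. rewrite h by lia; auto. }
  set (p := fun n => fst (a n)). set (q := fun n => snd (a n)).
  assert (hp : forall x, Rbar_lt (Rabs x) (CV_radius p)).
  { apply CV_radius_infinite. intros r hr.
    destruct (series_coef_bounded m om mu a r hr ha) as [M hM]. exists M. intros n.
    eapply Rle_trans; [| apply (hM n)]. assert (hpow := pow_lt r n hr).
    rewrite Rabs_mult, (Rabs_right (r ^ n)) by lra.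
    apply Rmult_le_compat_r; [lra |]. unfold p, Cnorm1.
    assert (h := Rabs_pos (snd (a n))). lra. }
  assert (hq : forall x, Rbar_lt (Rabs x) (CV_radius q)).
  { apply CV_radius_infinite. intros r hr.
    destruct (series_coef_bounded m om mu a r hr ha) as [M hM]. exists M. intros n.
    eapply Rle_trans; [| apply (hM n)]. assert (hpow := pow_lt r n hr).
    rewrite Rabs_mult, (Rabs_right (r ^ n)) by lra.
    apply Rmult_le_compat_r; [lra |]. unfold q, Cnorm1.
    assert (h := Rabs_pos (fst (a n))). lra. }
  exists (fun t => (PSeries p t, PSeries q t)),
         (fun t => (PSeries (PS_derive p) t, PSeries (PS_derive q) t)).
  assert (hPp : forall t, is_pseries p t (PSeries p t))
    by (intros; apply PSeries_correct, CV_radius_inside, hp).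
  assert (hPq : forall t, is_pseries q t (PSeries q t))
    by (intros; apply PSeries_correct, CV_radius_inside, hq).
  (* Both components of [(om t^m + mu) w] have this shape with real constants; [PS_incr_n] is
     multiplication by [t^m]. *)
  assert (comb : forall t c1 c2 c3 c4,
    is_pseries (PS_plus (PS_plus (PS_scal c1 p) (PS_scal c2 q))
                 (PS_incr_n (PS_plus (PS_scal c3 p) (PS_scal c4 q)) m)) t
      ((c1 * PSeries p t + c2 * PSeries q t)
       + t ^ m * (c3 * PSeries p t + c4 * PSeries q t))).
  { intros. rewrite <- pow_n_pow.
    apply (is_pseries_plus (K := R_AbsRing) (V := R_NormedModule)).
    - apply (is_pseries_plus (K := R_AbsRing) (V := R_NormedModule));
        apply (is_pseries_scal (K := R_AbsRing) (V := R_NormedModule)); auto; apply Rmult_comm.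
    - apply (is_pseries_incr_n (K := R_AbsRing) (V := R_NormedModule)).
      apply (is_pseries_plus (K := R_AbsRing) (V := R_NormedModule));
        apply (is_pseries_scal (K := R_AbsRing) (V := R_NormedModule)); auto; apply Rmult_comm. }
  split; [| split].
  - intros t _. split; split; simpl.
    + now apply is_derive_PSeries.
    + now apply is_derive_PSeries.
    + eapply is_derive_eqR.
      { apply is_derive_PSeries. rewrite CV_radius_derive. apply hp. }
      transitivity ((fst mu * PSeries p t + - snd mu * PSeries q t)
        + t ^ m * (fst om * PSeries p t + - snd om * PSeries q t)); [| ring].
      apply is_pseries_unique. eapply is_pseries_ext; [| apply comb].
      intros n. cbv beta delta [PS_plus]. rewrite PS_incr_n_simplify.
      unfold PS_derive. transitivity (INR (S n) * (INR (S (S n)) * fst (a (S (S n))))); auto.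
      rewrite ha. unfold series_step.
      assert (hn1 := not_0_INR (S n) (Nat.neq_succ_0 n)).
      assert (hn2 := not_0_INR (S (S n)) (Nat.neq_succ_0 (S n))).
      set (n1 := INR (S n)) in *; set (n2 := INR (S (S n))) in *.
      clearbody n1 n2. unfold PS_scal, plus, scal, p, q.
      match goal with |- @eq _ ?y ?z => change (@eq R y z) end.
      destruct le_lt_dec; unfold zero; simpl; unfold mult; simpl; field; auto.
    + eapply is_derive_eqR.
      { apply is_derive_PSeries. rewrite CV_radius_derive. apply hq. }
      transitivity ((snd mu * PSeries p t + fst mu * PSeries q t)
        + t ^ m * (snd om * PSeries p t + fst om * PSeries q t)); [| ring].
      apply is_pseries_unique. eapply is_pseries_ext; [| apply comb].
      intros n. cbv beta delta [PS_plus]. rewrite PS_incr_n_simplify.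
      unfold PS_derive. transitivity (INR (S n) * (INR (S (S n)) * snd (a (S (S n))))); auto.
      rewrite ha. unfold series_step.
      assert (hn1 := not_0_INR (S n) (Nat.neq_succ_0 n)).
      assert (hn2 := not_0_INR (S (S n)) (Nat.neq_succ_0 (S n))).
      set (n1 := INR (S n)) in *; set (n2 := INR (S (S n))) in *.
      clearbody n1 n2. unfold PS_scal, plus, scal, p, q.
      match goal with |- @eq _ ?y ?z => change (@eq R y z) end.
      destruct le_lt_dec; unfold zero; simpl; unfold mult; simpl; field; auto.
  - rewrite !PSeries_0. unfold p, q. rewrite h0. now destruct a0.
  - rewrite !PSeries_0. unfold PS_derive, p, q. rewrite h1. simpl.
    rewrite !Rmult_1_l. now destruct a1.
Qed.

(** * Wronskians and bases of solutions *)

Lemma is_sol_linear m om mu D u u1 v v1 c d :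
  is_sol m om mu D u u1 -> is_sol m om mu D v v1 ->
  is_sol m om mu D (fun t => Cadd (Cmul c (u t)) (Cmul d (v t)))
                   (fun t => Cadd (Cmul c (u1 t)) (Cmul d (v1 t))).
Proof.
  intros hu hv t ht. destruct (hu t ht), (hv t ht).
  split; (eapply is_Cderive_eq;
    [apply is_Cderive_add;
     (apply is_Cderive_mul; [apply is_Cderive_const | eassumption]) | cbv beta; ring]).
Qed.

Definition wronskian (u u1 v v1 : R -> Cx) (t : R) : Cx :=
  Cadd (Cmul (u t) (v1 t)) (Copp (Cmul (u1 t) (v t))).

Lemma wronskian_const m om mu D u u1 v v1 a b :
  is_sol m om mu D u u1 -> is_sol m om mu D v v1 ->
  (forall t, Rmin a b <= t <= Rmax a b -> D t) ->
  wronskian u u1 v v1 a = wronskian u u1 v v1 b.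
Proof.
  intros hu hv hD. apply is_Cderive_zero_const. intros t ht.
  destruct (hu t (hD t ht)), (hv t (hD t ht)).
  eapply is_Cderive_eq.
  - apply is_Cderive_add; [| apply is_Cderive_opp]; apply is_Cderive_mul; eassumption.
  - ring.
Qed.

Lemma Rmin_posR a b t : posR a -> posR b -> Rmin a b <= t <= Rmax a b -> posR t.
Proof. unfold posR, Rmin. destruct Rle_dec; lra. Qed.

(** Cramer's rule: [w W(u,v) = W(w,v) u + W(u,w) v] holds identically, and the Wronskians on the
    right are constant. This takes the place of a uniqueness theorem for the initial value
    problem. *)
Lemma solution_combination m om mu u u1 v v1 w w1 :
  is_sol m om mu posR u u1 -> is_sol m om mu posR v v1 ->
  is_sol m om mu posR w w1 ->
  (forall t, posR t -> wronskian u u1 v v1 t = Cone) ->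
  exists c d, forall t, posR t -> w t = Cadd (Cmul c (u t)) (Cmul d (v t)).
Proof.
  intros hu hv hw hW. assert (h1 : posR 1) by (unfold posR; lra).
  exists (wronskian w w1 v v1 1), (wronskian u u1 w w1 1). intros t ht.
  rewrite (wronskian_const m om mu posR w w1 v v1 1 t),
    (wronskian_const m om mu posR u u1 w w1 1 t); auto;
    try (intros; now apply (Rmin_posR 1 t)).
  transitivity (Cmul (w t) (wronskian u u1 v v1 t)).
  - rewrite hW by auto. ring.
  - unfold wronskian. ring.
Qed.

Lemma entire_basis m om mu : exists u u1 v v1,
  is_sol m om mu everywhere u u1 /\ is_sol m om mu everywhere v v1 /\
  forall t, wronskian u u1 v v1 t = Cone.
Proof.
  destruct (entire_solution m om mu Cone C0) as [u [u1 [hu [hu0 hu1]]]].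
  destruct (entire_solution m om mu C0 Cone) as [v [v1 [hv [hv0 hv1]]]].
  exists u, u1, v, v1. split; [exact hu |]. split; [exact hv |].
  intros t. rewrite (wronskian_const m om mu everywhere u u1 v v1 t 0); auto.
  - unfold wronskian. rewrite hu0, hu1, hv0, hv1. ring.
  - intros; exact I.
Qed.

Lemma entire_solution_at m om mu T a0 a1 :
  exists w w1, is_sol m om mu everywhere w w1 /\ w T = a0 /\ w1 T = a1.
Proof.
  destruct (entire_basis m om mu) as [u [u1 [v [v1 [hu [hv hW]]]]]].
  specialize (hW T). unfold wronskian in hW.
  set (c := Cadd (Cmul a0 (v1 T)) (Copp (Cmul a1 (v T)))).
  set (d := Cadd (Cmul (u T) a1) (Copp (Cmul (u1 T) a0))).
  exists (fun t => Cadd (Cmul c (u t)) (Cmul d (v t))),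
         (fun t => Cadd (Cmul c (u1 t)) (Cmul d (v1 t))).
  split; [now apply is_sol_linear |]. split.
  - transitivity (Cmul a0 (Cadd (Cmul (u T) (v1 T)) (Copp (Cmul (u1 T) (v T))))).
    + unfold c, d; ring.
    + rewrite hW; ring.
  - transitivity (Cmul a1 (Cadd (Cmul (u T) (v1 T)) (Copp (Cmul (u1 T) (v T))))).
    + unfold c, d; ring.
    + rewrite hW; ring.
Qed.

Lemma posR_solution_extends m om mu w w1 : is_sol m om mu posR w w1 ->
  exists W W1, is_sol m om mu everywhere W W1 /\ forall t, posR t -> w t = W t.
Proof.
  intros hw. destruct (entire_basis m om mu) as [u [u1 [v [v1 [hu [hv hW]]]]]].
  assert (hu' : is_sol m om mu posR u u1)
    by (intros t _; exact (hu t I)).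
  assert (hv' : is_sol m om mu posR v v1)
    by (intros t _; exact (hv t I)).
  destruct (solution_combination m om mu u u1 v v1 w w1) as [c [d h]]; auto.
  eexists _, _. split; [apply (is_sol_linear _ _ _ _ u u1 v v1 c d hu hv) | exact h].
Qed.

(** * Square integrability through antiderivatives *)

(** A bounded integral of [f], phrased through an antiderivative, so that comparing integrals
    amounts to applying [nonneg_derive_le] to a difference of antiderivatives. *)
Definition bounded_increments (D : R -> Prop) (f : R -> R) : Prop :=
  exists F M, (forall x, D x -> is_derive F x (f x)) /\
    forall a b, D a -> D b -> a <= b -> F b - F a <= M.

Lemma bounded_increments_ext (D : R -> Prop) f g :
  (forall x, D x -> f x = g x) -> bounded_increments D f -> bounded_increments D g.
Proof.
  intros h [F [M [hF hM]]]. exists F, M. split; auto.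
  intros x hx. rewrite <- h; auto.
Qed.

Lemma everywhere_antiderivative w w1 :
  (forall t, is_Cderive w t (w1 t)) ->
  exists F, forall t, is_derive F t (Cnormsq (w t)).
Proof.
  intros h. destruct (antiderivative_exists everywhere (fun t => Cnormsq (w t)) 0) as [F hF].
  - intros; exact I.
  - exact I.
  - intros. exists (mkposreal 1 Rlt_0_1). intros; exact I.
  - intros t _. eapply continuous_Cnormsq, h.
  - exists F. intros; apply hF; exact I.
Qed.

(** Here [F] is an antiderivative on the whole line, so it is increasing through [0] and [F 0]
    bounds it from below on the half-line. *)
Lemma bounded_increments_tail w F T M : (forall t, is_derive F t (Cnormsq (w t))) ->
  (forall b, T <= b -> F b <= M) -> bounded_increments posR (fun t => Cnormsq (w t)).
Proof.
  intros hF hM. exists F, (M - F 0). split; [intros; apply hF |].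
  intros a b ha hb hab.
  assert (mono : forall x y, x <= y -> F x <= F y).
  { intros x y hxy. apply nonneg_derive_le with (fun t => Cnormsq (w t)); auto.
    intros; apply Cnormsq_ge0. }
  assert (h1 := mono 0 a (Rlt_le _ _ ha)).
  assert (h2 := mono b (Rmax b T) (Rmax_l b T)).
  assert (h3 := hM (Rmax b T) (Rmax_r b T)). lra.
Qed.

(** * The limit-circle case *)

Lemma two_mul_le_of_sqr x p r k : 0 < k -> 0 <= p -> 0 <= r -> x * x <= p * r ->
  2 * Rabs x <= k * p + r / k.
Proof.
  intros hk hp hr hx.
  apply Rsqr_incr_0_var.
  - unfold Rsqr. replace (2 * Rabs x * (2 * Rabs x)) with (4 * (Rabs x * Rabs x)) by ring.
    assert (e : Rabs x * Rabs x = x * x) by (rewrite <- Rabs_mult, Rabs_right; nra).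
    rewrite e.
    replace ((k * p + r / k) * (k * p + r / k))
      with ((k * p - r / k) * (k * p - r / k) + 4 * (p * r)) by (field; lra).
    assert (h := Rle_0_sqr (k * p - r / k)). unfold Rsqr in h. lra.
  - apply Rplus_le_le_0_compat; [nra |]. apply Rdiv_le_0_compat; lra.
Qed.

(** Read [Q = t^m], [p = |w|^2], [r = |w'|^2], [s = Re (w' conj w)], [z = Re (mu w conj w')],
    [A = |mu|], [mr = Re mu], [M = m]. For the corrected energy [E] the conclusions say that the
    uncorrected energy is at most [2 E], and that [t E' <= (m/2 + 1/4) E]. The three thresholds on
    [t] make each error term at most [1/16] or [1/8] of the uncorrected energy, small enough in
    total for the slack [1/4]. *)
Lemma energy_inequality t Q p r s z A mr M :
  1 <= t -> t * (t * t) <= Q -> 0 <= M -> 0 <= p -> 0 <= r ->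
  s * s <= p * r -> z * z <= (A * A * p) * r -> Rabs mr <= A ->
  64 * (A * A) <= t -> 4 * (M * M) + 8 * M <= t -> 16 * (M * A) <= t ->
  (Q * p + r) / 2 <= Q * p + r + M / 2 * (s / t) /\
  M * (Q * p) + 2 * (t * z) + M / 2 * (r + (- Q + mr) * p) - M / 2 * (s / t)
    <= (M / 2 + / 4) * (Q * p + r + M / 2 * (s / t)).
Proof.
  intros ht hQ hM hp hr hs hz hmr ht1 ht2 ht3.
  assert (hA : 0 <= A) by (eapply Rle_trans; [apply Rabs_pos | exact hmr]).
  assert (hQt : t <= Q) by nra.
  assert (hQ1 : p <= Q * p) by nra.
  set (E := Q * p + r) in *.
  assert (bs := two_mul_le_of_sqr s p r 1 Rlt_0_1 hp hr hs).
  set (S := s / t). assert (eS : s = S * t) by (unfold S; field; lra).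
  assert (hS : 2 * (t * Rabs S) <= E).
  { rewrite eS, Rabs_mult, (Rabs_right t) in bs by lra. unfold E. lra. }
  assert (hS0 := Rabs_pos S).
  assert (k1 : M * Rabs S <= E / 16).
  { assert (8 * M * Rabs S <= t * Rabs S) by (apply Rmult_le_compat_r; nra). lra. }
  assert (k2 : M * M * Rabs S <= E / 8).
  { assert (4 * (M * M) * Rabs S <= t * Rabs S) by (apply Rmult_le_compat_r; nra). lra. }
  assert (hSl := Rle_abs S). assert (hSm := Rle_abs (- S)). rewrite Rabs_Ropp in hSm.
  assert (k3 : - (E / 16) <= M * S <= E / 16) by (split; nra).
  assert (k4 : - (E / 8) <= M * M * S) by nra.
  assert (k5 : 2 * (t * z) <= E / 8).
  { assert (bz' : 2 * (t * z) <= t * (2 * Rabs z)).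
    { assert (h := Rle_abs z). nra. }
    (* AM-GM with weight 8t, so that the factor t lands on p and is absorbed by Q >= t^3 *)
    assert (h := two_mul_le_of_sqr z (A * A * p) r (8 * t) ltac:(lra) ltac:(nra) hr hz).
    assert (e : t * (8 * t * (A * A * p) + r / (8 * t)) = 8 * (A * A) * (t * t) * p + r / 8)
      by (field; lra).
    assert (h' : t * (2 * Rabs z) <= 8 * (A * A) * (t * t) * p + r / 8)
      by (rewrite <- e; apply Rmult_le_compat_l; lra).
    assert (8 * (A * A) * (t * t) * p <= Q * p / 8).
    { assert (64 * (A * A) * (t * t) <= t * (t * t)) by (apply Rmult_le_compat_r; nra).
      assert (8 * (A * A) * (t * t) <= Q / 8) by lra.
      assert (8 * (A * A) * (t * t) * p <= Q / 8 * p) by (apply Rmult_le_compat_r; lra). lra. }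
    unfold E. lra. }
  assert (k6 : M * (mr * p) <= E / 16).
  { assert (mr <= A) by (assert (h := Rle_abs mr); lra).
    assert (M * (mr * p) <= M * A * p)
      by (rewrite Rmult_assoc; apply Rmult_le_compat_l, Rmult_le_compat_r; auto).
    assert (16 * (M * A) * p <= Q * p) by (apply Rmult_le_compat_r; lra).
    unfold E; lra. }
  assert (hE : 0 <= E) by (unfold E; nra).
  split; [lra |].
  replace (M * (Q * p) + 2 * (t * z) + M / 2 * (r + (- Q + mr) * p) - M / 2 * S)
    with (M / 2 * E + 2 * (t * z) + / 2 * (M * (mr * p)) - / 2 * (M * S))
    by (unfold E; field).
  replace ((M / 2 + / 4) * (E + M / 2 * S))
    with (M / 2 * E + / 4 * (M * M * S) + / 4 * E + / 8 * (M * S)) by field.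
  lra.
Qed.

Lemma solution_energy_bound m mu w w1 : (3 <= m)%nat ->
  is_sol m (Copp Cone) mu everywhere w w1 ->
  exists T K, 1 <= T /\ 0 <= K /\
    forall t, T <= t -> Cnormsq (w t) <= K * exp (- (5 / 4) * ln t).
Proof.
  intros hm hw.
  set (M := INR m). set (A := sqrt (Cnormsq mu)).
  assert (hM3 : 3 <= M) by (apply (le_INR 3) in hm; simpl in hm; unfold M; lra).
  assert (hAA : A * A = Cnormsq mu) by (apply sqrt_sqrt, Cnormsq_ge0).
  assert (hA0 : 0 <= A) by apply sqrt_pos.
  (* A sum of nonnegative terms, hence above each threshold of [energy_inequality]. *)
  set (T := 1 + 64 * (A * A) + (4 * (M * M) + 8 * M) + 16 * (M * A)).
  assert (hT : 1 <= T) by (unfold T; nra).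
  set (p := fun t => Cnormsq (w t)). set (r := fun t => Cnormsq (w1 t)).
  set (s := fun t => fst (Cmul (w1 t) (Cconj (w t)))).
  set (z := fun t => fst (Cmul mu (Cmul (w t) (Cconj (w1 t))))).
  set (E := fun t => t ^ m * p t + r t + M / 2 * (s t * / t)).
  set (dE := fun t => M * t ^ pred m * p t + 2 * z t
      + M / 2 * ((r t + (- t ^ m + fst mu) * p t) * / t - s t * / (t * t))).
  assert (hE : forall t, 0 < t -> is_derive E t (dE t)).
  { intros t ht. destruct (hw t I) as [d0 d1].
    assert (dp : is_derive p t (2 * s t)) by (apply is_derive_Cnormsq, d0).
    assert (dr : is_derive r t (2 * (- t ^ m * s t + z t))).
    { eapply is_derive_eqR; [apply is_derive_Cnormsq, d1 |].
      unfold s, z, coef; simpl; ring. }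
    assert (ds : is_derive s t (r t + (- t ^ m + fst mu) * p t)).
    { eapply is_derive_eqR;
        [exact (proj1 (is_Cderive_mul w1 (fun t => Cconj (w t)) t _ _ d1
          (is_Cderive_conj w t _ d0))) |].
      unfold r, p, coef, Cnormsq; simpl; ring. }
    assert (di : is_derive (fun t => / t) t (- 1 / t ^ 2)).
    { apply (is_derive_inv (fun t => t)); [| lra].
      apply (is_derive_id (K := R_AbsRing)). }
    unfold E. eapply is_derive_eqR.
    - derive_rules; try eassumption.
      + apply is_derive_powR.
      + apply (is_derive_const (K := R_AbsRing) (V := R_NormedModule)).
    - unfold dE. fold M. unfold zero; simpl. field; lra. }
  assert (hEn : forall t, T <= t ->
    (t ^ m * p t + r t) / 2 <= E t /\ t * dE t <= (M / 2 + / 4) * E t).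
  { intros t ht.
    assert (hAM : 0 <= M * A) by nra.
    assert (hMM : 0 <= M * M) by nra.
    assert (ht1 : 1 <= t) by lra.
    destruct (energy_inequality t (t ^ m) (p t) (r t) (s t) (z t) A (fst mu) M)
      as [h1 h2]; try (unfold T in ht; nra).
    - replace (t * (t * t)) with (t ^ 3) by ring. apply Rle_pow; auto.
    - apply Cnormsq_ge0.
    - apply Cnormsq_ge0.
    - eapply Rle_trans; [apply fst_sqr_le |].
      rewrite Cnormsq_mul, Cnormsq_conj. fold (p t) (r t). lra.
    - eapply Rle_trans; [apply fst_sqr_le |].
      rewrite !Cnormsq_mul, Cnormsq_conj, hAA. fold (p t) (r t). lra.
    - apply Rsqr_incr_0_var; auto. rewrite <- Rsqr_abs. unfold Rsqr. rewrite hAA.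
      apply fst_sqr_le.
    - split; [exact h1 |]. eapply Rle_trans; [| exact h2].
      apply Req_le. unfold dE. replace (t ^ m) with (t * t ^ pred m).
      + field. lra.
      + destruct m; [lia |]. simpl; ring. }
  set (c := M / 2 + / 4).
  (* [L = E t^(-c)] is nonincreasing beyond [T] because [t E' <= c E]. The exponent is not an
     integer, so powers are written with [exp] and [ln]. *)
  set (L := fun t => E t * exp (- c * ln t)).
  assert (hL : forall t, 0 < t ->
    is_derive L t (dE t * exp (- c * ln t) - c * (E t * / t) * exp (- c * ln t))).
  { intros t ht. unfold L.
    assert (de : is_derive (fun t => exp (- c * ln t)) t (- c * / t * exp (- c * ln t))).
    { auto_derive; [exact ht | field; lra]. }
    eapply is_derive_eqR; [apply is_derive_mulR; [apply hE, ht | exact de] | simpl; ring]. }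
  exists T, (2 * Rabs (L T)). split; [exact hT |]. split; [assert (h := Rabs_pos (L T)); lra |].
  intros t ht.
  assert (hLt : L t <= L T).
  { apply Ropp_le_cancel.
    apply (nonneg_derive_le (fun t => - L t) (fun t =>
      - (dE t * exp (- c * ln t) - c * (E t * / t) * exp (- c * ln t)))); auto.
    - intros x hx. apply is_derive_oppR, hL. lra.
    - intros x hx. destruct (hEn x ltac:(lra)) as [_ h].
      assert (he := exp_pos (- c * ln x)).
      assert (h' : dE x <= c * (E x * / x)).
      { apply Rmult_le_reg_l with x; [lra |].
        replace (x * (c * (E x * / x))) with (c * E x) by (field; lra). exact h. }
      nra. }
  destruct (hEn t ht) as [hE0 _].
  assert (hr : 0 <= r t) by apply Cnormsq_ge0.
  assert (htm : t ^ m = exp (M * ln t)).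
  { unfold M. rewrite <- Rpower_pow by lra. reflexivity. }
  assert (hEL : E t = L t * exp (c * ln t)).
  { unfold L. rewrite Rmult_assoc, <- exp_plus.
    replace (- c * ln t + c * ln t) with 0 by ring. rewrite exp_0; ring. }
  assert (h1 : p t * exp (M * ln t) <= 2 * Rabs (L T) * exp (c * ln t)).
  { rewrite <- htm. assert (he := exp_pos (c * ln t)).
    assert (L t * exp (c * ln t) <= Rabs (L T) * exp (c * ln t)).
    { apply Rmult_le_compat_r; [lra |]. eapply Rle_trans; [exact hLt | apply Rle_abs]. }
    lra. }
  assert (hln : 0 <= ln t) by (rewrite <- ln_1; apply ln_le; lra).
  apply Rmult_le_reg_r with (exp (M * ln t)); [apply exp_pos |].
  eapply Rle_trans; [exact h1 |].
  rewrite (Rmult_assoc _ (exp _) (exp _)), <- exp_plus. apply Rmult_le_compat_l.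
  - assert (h := Rabs_pos (L T)); lra.
  (* This is [1/4 - m/2 <= -5/4], that is [m >= 3], with equality at [m = 3]. *)
  - assert (hle : c * ln t <= - (5 / 4) * ln t + M * ln t) by (unfold c; nra).
    destruct hle as [hl | ->]; [left; now apply exp_increasing | right; reflexivity].
Qed.

Lemma limit_circle_entire m mu w w1 : (3 <= m)%nat ->
  is_sol m (Copp Cone) mu everywhere w w1 ->
  bounded_increments posR (fun t => Cnormsq (w t)).
Proof.
  intros hm hw.
  destruct (solution_energy_bound m mu w w1 hm hw) as [T [K [hT [hK hb]]]].
  destruct (everywhere_antiderivative w w1) as [F hF]; [intros t; apply (hw t I) |].
  apply bounded_increments_tail with F T (F T + 4 * K * exp (- / 4 * ln T)); auto.
  intros b hTb.
  (* [-4 K t^(-1/4)] is an antiderivative of the bound [K t^(-5/4)]. *)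
  set (H := fun t => - (4 * K * exp (- / 4 * ln t)) - F t).
  assert (h : H T <= H b).
  { apply nonneg_derive_le with (fun t => K * exp (- (5 / 4) * ln t) - Cnormsq (w t)); auto.
    - intros x hx. unfold H.
      apply (is_derive_subR (fun t => - (4 * K * exp (- / 4 * ln t)))); auto.
      auto_derive; [lra |].
      replace (- (5 / 4) * ln x) with (- / 4 * ln x + - ln x) by field.
      rewrite exp_plus, exp_Ropp, exp_ln by lra. field; lra.
    - intros x hx. specialize (hb x ltac:(lra)). lra. }
  unfold H in h. assert (h' := exp_pos (- / 4 * ln b)). nra.
Qed.

(** * The limit-point case *)

Definition flux (b : Cx) (w w1 : R -> Cx) (t : R) : R :=
  fst (Cmul b (Cmul (w1 t) (Cconj (w t)))).

Lemma is_derive_flux m om mu D b w w1 t : is_sol m om mu D w w1 -> D t ->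
  is_derive (flux b w w1) t
    (fst (Cmul b (coef m om mu t)) * Cnormsq (w t) + fst b * Cnormsq (w1 t)).
Proof.
  intros hw ht. destruct (hw t ht) as [d0 d1].
  eapply is_derive_eqR.
  - exact (proj1 (is_Cderive_mul (fun _ => b) _ t _ _ (is_Cderive_const b t)
      (is_Cderive_mul w1 (fun t => Cconj (w t)) t _ _ d1 (is_Cderive_conj w t _ d0)))).
  - unfold Cnormsq; simpl; ring.
Qed.

Lemma flux_sqr_le b w w1 t : Cnormsq b = 1 ->
  flux b w w1 t * flux b w w1 t <= Cnormsq (w t) * Cnormsq (w1 t).
Proof.
  intros hb. eapply Rle_trans; [apply fst_sqr_le |].
  rewrite !Cnormsq_mul, Cnormsq_conj, hb. lra.
Qed.

Lemma two_flux_le b w w1 t : Cnormsq b = 1 ->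
  2 * flux b w w1 t <= Cnormsq (w t) + Cnormsq (w1 t).
Proof.
  intros hb.
  assert (h := two_mul_le_of_sqr (flux b w w1 t) _ _ 1 Rlt_0_1
    (Cnormsq_ge0 (w t)) (Cnormsq_ge0 (w1 t)) (flux_sqr_le b w w1 t hb)).
  assert (h' := Rle_abs (flux b w w1 t)). lra.
Qed.

(* If [u + c v] vanishes, then [(u1 + c v1) v = -1] by the Wronskian relation. *)
Lemma flux_shift b u u1 v v1 c d : Cnormsq b = 1 ->
  Cadd u (Cmul c v) = C0 -> Cadd (Cmul u v1) (Copp (Cmul u1 v)) = Cone ->
  let e := Cadd d (Copp c) in
  let X := fst (Cmul b (Cmul (Cadd u1 (Cmul d v1)) (Cconj (Cadd u (Cmul d v)))))
           - Cnormsq e * fst (Cmul b (Cmul v1 (Cconj v))) in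
  X * X <= Cnormsq e.
Proof.
  intros hb hc hW e X.
  assert (hY : Cmul (Cadd u1 (Cmul c v1)) v = Copp Cone).
  { rewrite <- hW.
    transitivity (Cadd (Cmul (Cadd u (Cmul c v)) v1) (Cadd (Cmul u1 v) (Copp (Cmul u v1)))).
    - ring.
    - rewrite hc. ring. }
  (* Since [u + c v = 0], one has [u + d v = e v] and [u1 + d v1 = (u1 + c v1) + e v1]. The part
     with [e v1] contributes [|e|^2] times the flux of [v], which [X] subtracts. *)
  assert (eX : X = fst (Cmul b (Cmul (Cadd u1 (Cmul c v1)) (Cconj (Cmul e v))))).
  { unfold X. replace (Cadd u (Cmul d v)) with (Cmul e v).
    - unfold e, Cnormsq; simpl; ring.
    - transitivity (Cadd (Cadd u (Cmul c v)) (Cmul e v)).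
      + rewrite hc; ring.
      + unfold e; ring. }
  rewrite eX. eapply Rle_trans; [apply fst_sqr_le |].
  rewrite !Cnormsq_mul, Cnormsq_conj, Cnormsq_mul, hb.
  assert (h := f_equal Cnormsq hY). rewrite Cnormsq_mul in h.
  replace (Cnormsq (Copp Cone)) with 1 in h by (unfold Cnormsq; simpl; ring).
  replace (1 * (Cnormsq (Cadd u1 (Cmul c v1)) * (Cnormsq e * Cnormsq v)))
    with (Cnormsq e * (Cnormsq (Cadd u1 (Cmul c v1)) * Cnormsq v)) by ring.
  rewrite h. lra.
Qed.

Lemma cauchy_limit_rate (x e : nat -> R) :
  (forall n k, (n <= k)%nat -> Rabs (x k - x n) <= e n) ->
  (forall eps, 0 < eps -> exists n, e n < eps) ->
  exists l, forall n, Rabs (l - x n) <= e n.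
Proof.
  intros hx he. destruct (R_complete x) as [l hl].
  - intros eps heps. destruct (he (eps / 2)) as [n hn]; [lra |].
    exists n. intros j k hj hk. unfold R_dist.
    replace (x j - x k) with ((x j - x n) - (x k - x n)) by ring.
    assert (h1 := hx n j hj). assert (h2 := hx n k hk).
    assert (h3 := Rabs_triang (x j - x n) (- (x k - x n))). rewrite Rabs_Ropp in h3.
    unfold Rminus in *. lra.
  - exists l. intros n. apply Rnot_lt_le. intros hlt.
    destruct (hl (Rabs (l - x n) - e n)) as [K hK]; [lra |].
    specialize (hK (max n K) ltac:(lia)). unfold R_dist in hK.
    assert (h1 := hx n (max n K) ltac:(lia)).
    assert (h2 := Rabs_triang (x (max n K) - x n) (- (x (max n K) - l))).
    rewrite Rabs_Ropp in h2.
    replace (x (max n K) - x n + - (x (max n K) - l)) with (l - x n) in h2 by ring.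
    lra.
Qed.

Lemma Rabs_le_of_sqr x g D : 0 < g -> x * x <= D -> D * (g * g) <= 1 -> Rabs x <= / g.
Proof.
  intros hg h1 h2. assert (hi := Rinv_0_lt_compat g hg).
  apply Rsqr_incr_0_var; [| lra]. rewrite <- Rsqr_abs. unfold Rsqr.
  apply Rmult_le_reg_r with (g * g); [nra |].
  replace (/ g * / g * (g * g)) with 1 by (field; lra). nra.
Qed.

(** * Weyl's limit-point argument for a flux that increases from [T] on *)

Section LimitPoint.

Variables (m : nat) (om mu b : Cx) (T del : R).
Hypotheses (hb : Cnormsq b = 1) (hT : 0 < T) (hdel : 0 < del)
  (hbr : del <= fst b)
  (hq : forall t, T <= t -> del <= fst (Cmul b (coef m om mu t))).

Let df (w w1 : R -> Cx) t :=
  fst (Cmul b (coef m om mu t)) * Cnormsq (w t) + fst b * Cnormsq (w1 t).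

Lemma flux_derive_ge w w1 t : T <= t ->
  del * (Cnormsq (w t) + Cnormsq (w1 t)) <= df w w1 t.
Proof.
  intros ht. unfold df. specialize (hq t ht).
  assert (h1 := Cnormsq_ge0 (w t)). assert (h2 := Cnormsq_ge0 (w1 t)). nra.
Qed.

Lemma flux_derive_ge0 w w1 t : T <= t -> 0 <= df w w1 t.
Proof.
  intros ht. eapply Rle_trans; [| apply flux_derive_ge, ht].
  assert (h1 := Cnormsq_ge0 (w t)). assert (h2 := Cnormsq_ge0 (w1 t)). nra.
Qed.

Lemma flux_mono w w1 s t : is_sol m om mu everywhere w w1 -> T <= s <= t ->
  flux b w w1 s <= flux b w w1 t.
Proof.
  intros hw hst. apply nonneg_derive_le with (df w w1); [lra | |].
  - intros x _. eapply is_derive_flux; [exact hw | exact I].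
  - intros x hx. apply flux_derive_ge0. lra.
Qed.

Variables (u u1 v v1 : R -> Cx).
Hypotheses (hu : is_sol m om mu everywhere u u1) (hv : is_sol m om mu everywhere v v1)
  (hvT : v T = Cone) (hv1T : v1 T = Cconj b)
  (hW : forall t, wronskian u u1 v v1 t = Cone).

Let g := flux b v v1.

(** Twice the flux is at most [|v|^2 + |v'|^2], so [g' >= 2 del g], and [g >= 1] from [T] on turns
    this into linear growth. That already makes the Weyl discs shrink to a point. *)
Lemma dominant_flux_growth t : T <= t -> 1 + 2 * del * (t - T) <= g t.
Proof.
  intros ht.
  (* The data [v = 1], [v' = conj b] at [T] give the flux [|b|^2]. *)
  assert (gT : g T = 1).
  { unfold g, flux. rewrite hvT, hv1T, <- hb. unfold Cnormsq; simpl; ring. }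
  assert (g1 : forall s, T <= s -> 1 <= g s).
  { intros s hs. rewrite <- gT. apply flux_mono; auto; lra. }
  enough (h : g T - 2 * del * T <= g t - 2 * del * t) by (rewrite gT in h; lra).
  apply (nonneg_derive_le (fun t => g t - 2 * del * t) (fun t => df v v1 t - 2 * del)); auto.
  - intros x hx. apply is_derive_subR.
    + eapply is_derive_flux; [exact hv | exact I].
    + auto_derive; [exact I | ring].
  - intros x hx. assert (h1 := flux_derive_ge v v1 x ltac:(lra)).
    assert (h2 := two_flux_le b v v1 x hb). assert (h3 := g1 x ltac:(lra)).
    fold g in h2. nra.
Qed.

Lemma dominant_flux_ge1 t : T <= t -> 1 <= g t.
Proof. intros ht. assert (h := dominant_flux_growth t ht). nra. Qed.

Let comb (c : Cx) (t : R) := Cadd (u t) (Cmul c (v t)).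
Let comb1 (c : Cx) (t : R) := Cadd (u1 t) (Cmul c (v1 t)).

Lemma comb_sol c : is_sol m om mu everywhere (comb c) (comb1 c).
Proof.
  intros t ht. destruct (hu t ht), (hv t ht). unfold comb, comb1.
  split; (eapply is_Cderive_eq; [apply is_Cderive_add; [eassumption |
     apply is_Cderive_mul; [apply is_Cderive_const | eassumption]] | cbv beta; ring]).
Qed.

Lemma comb_vanishing t : T <= t -> comb (Copp (Cmul (u t) (Cinv (v t)))) t = C0.
Proof.
  intros ht. assert (hi : Cmul (v t) (Cinv (v t)) = Cone).
  - apply Cmul_inv. intros h0. assert (h := dominant_flux_ge1 t ht).
    unfold g, flux in h. rewrite h0 in h. unfold C0 in h; simpl in h. lra.
  - unfold comb.
    transitivity (Cmul (u t) (Cadd Cone (Copp (Cmul (v t) (Cinv (v t)))))); [ring |].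
    rewrite hi. ring.
Qed.

Lemma comb_flux_shift c d t : comb c t = C0 ->
  let e := Cnormsq (Cadd d (Copp c)) in
  (flux b (comb d) (comb1 d) t - e * g t) * (flux b (comb d) (comb1 d) t - e * g t) <= e.
Proof. intros hc. apply (flux_shift b (u t) (u1 t) (v t) (v1 t) c d hb hc (hW t)). Qed.

(* The Weyl discs [{d : flux of u + d v at t is <= 0}] are nested and shrink to a point. *)
Lemma recessive_solution : exists c, forall t, T <= t -> flux b (comb c) (comb1 c) t <= 0.
Proof.
  set (tn := fun n => T + INR n).
  set (c := fun n => Copp (Cmul (u (tn n)) (Cinv (v (tn n))))).
  assert (htn : forall n, T <= tn n) by (intros n; unfold tn; assert (h := pos_INR n); lra).
  assert (hc : forall n, comb (c n) (tn n) = C0) by (intros n; apply comb_vanishing, htn).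
  clearbody c.
  assert (hg : forall n, 1 <= g (tn n)) by (intros; apply dominant_flux_ge1; auto).
  (* The flux of [u + c_k v] vanishes at [t_k], so it is nonpositive at the earlier time [t_n]. With
     [f <= 0], the bound [(f - e G)^2 <= e] yields [e^2 G^2 <= e], so [c_k] lies within [1/G] of
     [c_n]. *)
  assert (key : forall n k, (n <= k)%nat ->
    Cnormsq (Cadd (c k) (Copp (c n))) * (g (tn n) * g (tn n)) <= 1).
  { intros n k hnk.
    assert (h0 : flux b (comb (c k)) (comb1 (c k)) (tn n) <= 0).
    { eapply Rle_trans.
      - apply (flux_mono _ _ (tn n) (tn k) (comb_sol (c k))).
        split; auto. unfold tn. apply le_INR in hnk. lra.
      - apply Req_le. unfold flux. rewrite (hc k). unfold C0; simpl; ring. }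
    assert (h1 := comb_flux_shift (c n) (c k) (tn n) (hc n)). simpl in h1.
    assert (he := Cnormsq_ge0 (Cadd (c k) (Copp (c n)))).
    specialize (hg n).
    set (e := Cnormsq (Cadd (c k) _)) in *. set (G := g _) in *. set (f := flux _ _ _ _) in *.
    destruct he as [he | he]; [| rewrite <- he; lra].
    assert (h2 : 0 <= - f * (e * G)) by (apply Rmult_le_pos; nra).
    assert (h3 := Rle_0_sqr f). unfold Rsqr in h3.
    apply Rmult_le_reg_l with e; auto. lra. }
  assert (hinf : forall eps, 0 < eps -> exists n, / g (tn n) < eps).
  { intros eps heps. destruct (INR_unbounded (/ eps / (2 * del))) as [n hn].
    exists n. assert (h := dominant_flux_growth (tn n) (htn n)).
    assert (h' : / eps < g (tn n)).
    { unfold tn in h at 1. replace (T + INR n - T) with (INR n) in h by ring.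
      apply (Rmult_lt_compat_l (2 * del)) in hn; [| lra].
      replace (2 * del * (/ eps / (2 * del))) with (/ eps) in hn by (field; lra). lra. }
    rewrite <- (Rinv_inv eps). apply Rinv_lt_contravar; auto.
    apply Rmult_lt_0_compat; [apply Rinv_0_lt_compat, heps | specialize (hg n); lra]. }
  destruct (cauchy_limit_rate (fun n => fst (c n)) (fun n => / g (tn n))) as [l1 hl1].
  { intros n k hnk. apply Rabs_le_of_sqr with (2 := fst_sqr_le (Cadd (c k) (Copp (c n)))).
    - specialize (hg n); lra.
    - auto. }
  { exact hinf. }
  destruct (cauchy_limit_rate (fun n => snd (c n)) (fun n => / g (tn n))) as [l2 hl2].
  { intros n k hnk. apply Rabs_le_of_sqr with (2 := snd_sqr_le (Cadd (c k) (Copp (c n)))).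
    - specialize (hg n); lra.
    - auto. }
  { exact hinf. }
  set (l := (l1, l2) : Cx). exists l. intros t ht. apply Rnot_lt_le. intros hlt.
  set (eta := flux b (comb l) (comb1 l) t) in *.
  (* A positive flux [eta] at [t] persists at [t_n]. There, however, it is at most
     [e G + 2/G <= 4/G], because both coordinates of [l - c_n] are at most [1/G] in absolute value
     and so [e <= 2/G^2]. *)
  assert (hn : exists n, / g (tn n) < eta / 4 /\ t <= tn n).
  { destruct (hinf (eta / 4)) as [n1 hn1]; [lra |].
    destruct (INR_unbounded t) as [n2 hn2].
    exists (max n1 n2). split.
    - eapply Rle_lt_trans; [| exact hn1]. apply Rinv_le_contravar; [specialize (hg n1); lra |].
      apply flux_mono; auto. split; auto. unfold tn.
      assert (h := le_INR n1 (max n1 n2) ltac:(lia)). lra.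
    - unfold tn. assert (h := le_INR n2 (max n1 n2) ltac:(lia)). lra. }
  destruct hn as [n [hn htle]].
  assert (h0 : eta <= flux b (comb l) (comb1 l) (tn n))
    by (apply flux_mono; [apply comb_sol | lra]).
  assert (h1 := comb_flux_shift (c n) l (tn n) (hc n)). simpl in h1.
  assert (hG := hg n). specialize (hl1 n). specialize (hl2 n).
  set (G := g (tn n)) in *. set (f := flux b (comb l) _ (tn n)) in *.
  set (e := Cnormsq (Cadd l (Copp (c n)))) in *.
  assert (hiG : 0 < / G) by (apply Rinv_0_lt_compat; lra).
  assert (he : e <= 2 * (/ G * / G)).
  { unfold e, Cnormsq, l; simpl.
    assert (s1 : Rsqr (l1 - fst (c n)) <= Rsqr (/ G))
      by (apply Rsqr_le_abs_1; rewrite (Rabs_right (/ G)) by lra; exact hl1).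
    assert (s2 : Rsqr (l2 - snd (c n)) <= Rsqr (/ G))
      by (apply Rsqr_le_abs_1; rewrite (Rabs_right (/ G)) by lra; exact hl2).
    unfold Rsqr in *. unfold Rminus in *. lra. }
  assert (heG : e * G <= 2 * / G).
  { replace (2 * / G) with (2 * (/ G * / G) * G) by (field; lra).
    apply Rmult_le_compat_r; lra. }
  assert (hfe : f - e * G <= 2 * / G).
  { apply Rsqr_incr_0_var; [unfold Rsqr | lra].
    eapply Rle_trans; [exact h1 |]. nra. }
  lra.
Qed.

Lemma recessive_square_integrable c :
  (forall t, T <= t -> flux b (comb c) (comb1 c) t <= 0) ->
  bounded_increments posR (fun t => Cnormsq (comb c t)).
Proof.
  intros hc.
  destruct (everywhere_antiderivative (comb c) (comb1 c)) as [F hF].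
  { intros t. apply (comb_sol c t I). }
  apply bounded_increments_tail with F T (F T - / del * flux b (comb c) (comb1 c) T); auto.
  intros t ht.
  assert (h : flux b (comb c) (comb1 c) T - del * F T
    <= flux b (comb c) (comb1 c) t - del * F t).
  { apply (nonneg_derive_le (fun t => flux b (comb c) (comb1 c) t - del * F t)
      (fun t => df (comb c) (comb1 c) t - del * Cnormsq (comb c t))); auto.
    - intros x _. apply is_derive_subR.
      + eapply is_derive_flux; [apply comb_sol | exact I].
      + apply (is_derive_scal F), hF.
    - intros x hx. assert (h1 := flux_derive_ge (comb c) (comb1 c) x ltac:(lra)).
      assert (h2 := Cnormsq_ge0 (comb1 c x)). nra. }
  specialize (hc t ht).
  apply Rmult_le_reg_l with del; auto.
  replace (del * (F T - / del * flux b (comb c) (comb1 c) T))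
    with (del * F T - flux b (comb c) (comb1 c) T) by (field; lra). lra.
Qed.

(* Since [flux^2 <= |v|^2 |v'|^2] and [flux' >= del |v'|^2], one has
   [|v|^2 >= del flux^2 / flux' >= del (2 - flux' / flux^2)]. *)
Lemma dominant_integral_growth F : (forall t, is_derive F t (Cnormsq (v t))) ->
  forall t, T <= t -> F T + 2 * del * (t - T) - del <= F t.
Proof.
  intros hF t ht.
  assert (h : F T - 2 * del * T - del * / g T <= F t - 2 * del * t - del * / g t).
  { apply (nonneg_derive_le (fun t => F t - 2 * del * t - del * / g t)
      (fun t => Cnormsq (v t) - 2 * del - del * (- df v v1 t / g t ^ 2))); auto.
    - intros x hx. assert (hg := dominant_flux_ge1 x ltac:(lra)).
      apply is_derive_subR; [apply is_derive_subR; [apply hF |] |].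
      + auto_derive; [exact I | ring].
      + apply (is_derive_scal (fun t => / g t)). apply is_derive_inv; [| lra].
        eapply is_derive_flux; [exact hv | exact I].
    - intros x hx. assert (hg := dominant_flux_ge1 x ltac:(lra)).
      assert (h1 := flux_derive_ge v v1 x ltac:(lra)).
      assert (h2 := flux_sqr_le b v v1 x hb). fold g in h2.
      assert (h3 := Cnormsq_ge0 (v x)). assert (h4 := Cnormsq_ge0 (v1 x)).
      set (D := df v v1 x) in *. set (p := Cnormsq (v x)) in *.
      set (r := Cnormsq (v1 x)) in *. set (G := g x) in *.
      replace (p - 2 * del - del * (- D / G ^ 2))
        with ((p * (G * G) - 2 * del * (G * G) + del * D) * / (G * G)) by (field; lra).
      apply Rmult_le_pos; [| left; apply Rinv_0_lt_compat; nra].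
      assert (hr : 0 < r) by (destruct h4 as [| h4]; auto; rewrite <- h4 in h2; nra).
      assert (hG2 : 0 < G * G) by nra.
      assert (k1 : del * (del * r) <= del * D) by nra.
      assert (k2 := Rle_0_sqr (G * G - del * r)). unfold Rsqr in k2.
      assert (k3 : (G * G) * (G * G) <= (p * r) * (G * G)) by (apply Rmult_le_compat_r; lra).
      (* Multiplying by [r] allows [G^2 <= p r] to be used; what is left is the square
         [(G^2 - del r)^2]. *)
      assert (k4 : 0 <= r * (p * (G * G) - 2 * del * (G * G) + del * (del * r))) by lra.
      assert (k5 : 0 <= p * (G * G) - 2 * del * (G * G) + del * (del * r)).
      { apply Rmult_le_reg_l with r; auto. lra. }
      lra. }
  assert (hg1 := dominant_flux_ge1 T (Rle_refl T)).
  assert (hg2 := dominant_flux_ge1 t ht).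
  assert (i1 : / g T <= 1) by (rewrite <- Rinv_1; apply Rinv_le_contravar; lra).
  assert (i2 : 0 < / g t) by (apply Rinv_0_lt_compat; lra). nra.
Qed.

(** If [d] were nonzero, [d v = w - c w0] would be square integrable, against the linear growth of
    the integral of [|v|^2]. *)
Lemma not_multiple_of_dominant w0 w c d :
  bounded_increments posR (fun t => Cnormsq (w0 t)) ->
  bounded_increments posR (fun t => Cnormsq (w t)) ->
  (forall t, posR t -> w t = Cadd (Cmul c (w0 t)) (Cmul d (v t))) -> d = C0.
Proof.
  intros [F0 [M0 [hF0 hM0]]] [F [M [hF hM]]] hw.
  apply Cnormsq_eq0. apply Rle_antisym; [| apply Cnormsq_ge0].
  apply Rnot_lt_le. intros hd.
  destruct (everywhere_antiderivative v v1) as [Fv hFv].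
  { intros t. apply (hv t I). }
  set (nd := Cnormsq d) in *. set (nc := Cnormsq c).
  set (B := 2 * M + 2 * nc * M0).
  assert (hB : forall t, T <= t -> nd * (Fv t - Fv T) <= B).
  { intros t ht.
    assert (h : 2 * F T + 2 * nc * F0 T - nd * Fv T <= 2 * F t + 2 * nc * F0 t - nd * Fv t).
    { apply (nonneg_derive_le (fun t => 2 * F t + 2 * nc * F0 t - nd * Fv t)
        (fun t => 2 * Cnormsq (w t) + 2 * nc * Cnormsq (w0 t) - nd * Cnormsq (v t))); auto.
      - intros x hx. assert (hx0 : posR x) by (unfold posR; lra).
        apply is_derive_subR; [apply is_derive_addR |].
        + apply (is_derive_scal F), hF, hx0.
        + apply (is_derive_scal F0), hF0, hx0.
        + apply (is_derive_scal Fv), hFv.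
      - intros x hx. assert (hx0 : posR x) by (unfold posR; lra).
        assert (e : Cmul d (v x) = Cadd (w x) (Copp (Cmul c (w0 x))))
          by (rewrite hw; [ring | auto]).
        assert (e1 := Cnormsq_mul d (v x)). assert (e2 := Cnormsq_mul c (w0 x)).
        fold nd in e1. fold nc in e2. rewrite <- e1, Rmult_assoc, <- e2, e.
        (* Parallelogram law: [2 |w|^2 + 2 |c w0|^2 - |w - c w0|^2 = |w + c w0|^2]. *)
        assert (s1 := Cnormsq_ge0 (Cadd (w x) (Cmul c (w0 x)))).
        unfold Cnormsq in *; simpl in *. lra. }
    assert (h1 := hM T t hT (Rlt_le_trans _ _ _ hT ht) ht).
    assert (h2 := hM0 T t hT (Rlt_le_trans _ _ _ hT ht) ht).
    assert (h3 := Cnormsq_ge0 c). fold nc in h3. unfold B. nra. }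
  (* Chosen so that [dominant_integral_growth] gives an increment of at least [1 + |B| / nd], which
     exceeds what [hB] permits. *)
  set (t := T + (1 + Rabs B / nd + del) / (2 * del)).
  assert (hBd : 0 <= Rabs B / nd) by (apply Rdiv_le_0_compat; [apply Rabs_pos | exact hd]).
  assert (ht : T <= t).
  { unfold t. assert (h : 0 <= (1 + Rabs B / nd + del) / (2 * del))
      by (apply Rdiv_le_0_compat; lra). lra. }
  assert (h1 := hB t ht). assert (h2 := dominant_integral_growth Fv hFv t ht).
  assert (e : 2 * del * (t - T) = 1 + Rabs B / nd + del) by (unfold t; field; lra).
  assert (h3 : nd * (1 + Rabs B / nd) <= B).
  { eapply Rle_trans; [| exact h1]. apply Rmult_le_compat_l; lra. }
  replace (nd * (1 + Rabs B / nd)) with (nd + Rabs B) in h3 by (field; lra).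
  assert (h4 := Rle_abs B). lra.
Qed.

Lemma limit_point_of_basis : exists w0 w01, is_sol m om mu posR w0 w01 /\
  bounded_increments posR (fun t => Cnormsq (w0 t)) /\
  (exists t, posR t /\ w0 t <> C0) /\
  forall w w1, is_sol m om mu posR w w1 -> bounded_increments posR (fun t => Cnormsq (w t)) ->
    exists c, forall t, posR t -> w t = Cmul c (w0 t).
Proof.
  destruct recessive_solution as [c hc].
  assert (hs := comb_sol c). assert (hL2 := recessive_square_integrable c hc).
  assert (hs' : is_sol m om mu posR (comb c) (comb1 c)) by (intros t _; exact (hs t I)).
  assert (hv' : is_sol m om mu posR v v1) by (intros t _; exact (hv t I)).
  assert (hWc : forall t, wronskian (comb c) (comb1 c) v v1 t = Cone).
  { intros t. rewrite <- (hW t). unfold wronskian, comb, comb1. ring. }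
  exists (comb c), (comb1 c). split; [exact hs' |]. split; [exact hL2 |]. split.
  (* A combination vanishing on the half-line would also have zero derivative at [T], contradicting
     its Wronskian [1] with [v]. *)
  - apply NNPP. intros hno.
    assert (h0 : forall t, posR t -> comb c t = C0)
      by (intros t ht; apply NNPP; intros h; apply hno; now exists t).
    destruct (hs T I) as [[d1 d2] _].
    assert (hloc : locally T posR).
    { exists (mkposreal T hT). intros y hy. apply Rabs_def2 in hy. simpl in hy.
      unfold minus, plus, opp in hy; simpl in hy. unfold posR. lra. }
    assert (z : comb1 c T = C0).
    { apply injective_projections.
      - rewrite <- (is_derive_unique _ _ _ d1). apply is_derive_unique.
        apply (is_derive_ext_loc (fun _ => 0)).
        + apply filter_imp with (2 := hloc). intros y hy. now rewrite h0.
        + apply (is_derive_const (K := R_AbsRing) (V := R_NormedModule)).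
      - rewrite <- (is_derive_unique _ _ _ d2). apply is_derive_unique.
        apply (is_derive_ext_loc (fun _ => 0)).
        + apply filter_imp with (2 := hloc). intros y hy. now rewrite h0.
        + apply (is_derive_const (K := R_AbsRing) (V := R_NormedModule)). }
    specialize (hWc T). unfold wronskian in hWc. rewrite z, (h0 T hT) in hWc.
    apply (f_equal fst) in hWc. unfold C0, Cone in hWc. simpl in hWc. lra.
  - intros w w1 hw hL.
    destruct (solution_combination m om mu (comb c) (comb1 c) v v1 w w1) as [k [d hd]]; auto.
    exists k. intros t ht. rewrite (hd t ht).
    rewrite (not_multiple_of_dominant (comb c) w k d hL2 hL hd). ring.
Qed.

End LimitPoint.

Lemma limit_point_posR m om mu b : (1 <= m)%nat ->
  Cnormsq b = 1 -> 0 < fst b -> 0 < fst (Cmul b om) ->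
  exists w0 w01, is_sol m om mu posR w0 w01 /\
  bounded_increments posR (fun t => Cnormsq (w0 t)) /\
  (exists t, posR t /\ w0 t <> C0) /\
  forall w w1, is_sol m om mu posR w w1 -> bounded_increments posR (fun t => Cnormsq (w t)) ->
    exists c, forall t, posR t -> w t = Cmul c (w0 t).
Proof.
  intros hm hb hbr hbom.
  set (be := fst (Cmul b om)) in *. set (ga := fst (Cmul b mu)).
  (* From [t^m >= t >= T] follows [t^m be + ga >= be + fst b], so [fst b] can serve as [del]. *)
  set (T := 1 + (Rabs ga + fst b) / be).
  assert (hga := Rabs_pos ga).
  assert (hT : 1 <= T).
  { unfold T. assert (h : 0 <= (Rabs ga + fst b) / be) by (apply Rdiv_le_0_compat; lra). lra. }
  assert (hq : forall t, T <= t -> fst b <= fst (Cmul b (coef m om mu t))).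
  { intros t ht.
    replace (fst (Cmul b (coef m om mu t))) with (t ^ m * be + ga)
      by (unfold be, ga, coef; simpl; ring).
    assert (h1 : t <= t ^ m).
    { rewrite <- (pow_1 t) at 1. apply Rle_pow; [lra | exact hm]. }
    assert (h2 : T * be <= t ^ m * be) by (apply Rmult_le_compat_r; lra).
    assert (h3 : T * be = be + Rabs ga + fst b) by (unfold T; field; lra).
    assert (h4 := Rle_abs (- ga)). rewrite Rabs_Ropp in h4. lra. }
  (* The data [(0, -1)] for [u] give Wronskian [1] with [v] at [T] whatever [b] is, since
     [v T = 1]. *)
  destruct (entire_solution_at m om mu T C0 (Copp Cone)) as [u [u1 [hu [hu0 hu1]]]].
  destruct (entire_solution_at m om mu T Cone (Cconj b)) as [v [v1 [hv [hv0 hv1]]]].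
  apply (limit_point_of_basis m om mu b T (fst b)) with u u1 v v1; auto; try lra.
  intros t. rewrite (wronskian_const m om mu everywhere u u1 v v1 t T); auto.
  - unfold wronskian. rewrite hu0, hu1, hv0, hv1. ring.
  - intros; exact I.
Qed.

(** * Reduction of the half-line equations *)

Lemma sgnb_sqr s : sgnb s * sgnb s = 1.
Proof. destruct s; simpl; ring. Qed.

Lemma sgnb_mulK s x : sgnb s * (sgnb s * x) = x.
Proof. rewrite <- Rmult_assoc, sgnb_sqr; ring. Qed.

Lemma half_posR s x : half s x <-> posR (sgnb s * x).
Proof. unfold half, posR, sgnb; destruct s; split; lra. Qed.

Lemma half_sgnb s t : posR t -> half s (sgnb s * t).
Proof. intros h. apply half_posR. now rewrite sgnb_mulK. Qed.

Lemma cis_add a b : cis (a + b) = Cmul (cis a) (cis b).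
Proof.
  unfold cis. apply injective_projections; simpl.
  - apply cos_plus.
  - rewrite sin_plus; ring.
Qed.

Lemma Cpow_cis a n : Cpow (cis a) n = cis (INR n * a).
Proof.
  induction n.
  - simpl. unfold cis. now rewrite Rmult_0_l, cos_0, sin_0.
  - rewrite S_INR. change (Cmul (cis a) (Cpow (cis a) n) = cis ((INR n + 1) * a)).
    rewrite IHn, <- cis_add. f_equal; ring.
Qed.

Lemma Cpow_mul z w n : Cpow (Cmul z w) n = Cmul (Cpow z n) (Cpow w n).
Proof.
  induction n; simpl.
  - change (Cone = Cmul Cone Cone). ring.
  - rewrite IHn. ring.
Qed.

Lemma Cpow_RtoC x n : Cpow (RtoC x) n = RtoC (x ^ n).
Proof.
  induction n; simpl; auto. rewrite IHn. cx; ring.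
Qed.

(* Since [-1 = cis (+-PI)], one has [-(ix)^(N+2) e^(+-(N+4) i phi) = om |x|^(N+2)]. *)
Definition om_of (N : nat) (phi : R) (s : bool) : Cx :=
  cis (sgnb s * ((INR N + 4) * (phi + PI / 2))).

Definition mu_of (phi : R) (lam : Cx) (s : bool) : Cx :=
  Copp (Cmul (cis (sgnb s * 2 * phi)) lam).

Lemma cis_sgnb_half_pi s : cis (sgnb s * (PI / 2)) = Cmul (RtoC (sgnb s)) Ci.
Proof.
  unfold cis, Cmul, RtoC, Ci; destruct s; simpl.
  - rewrite Rmult_1_l, cos_PI2, sin_PI2. apply injective_projections; simpl; ring.
  - replace (-1 * (PI / 2)) with (- (PI / 2)) by ring.
    rewrite cos_neg, sin_neg, cos_PI2, sin_PI2. apply injective_projections; simpl; ring.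
Qed.

Lemma cis_sgnb_pi s : cis (sgnb s * PI) = Copp Cone.
Proof.
  replace (sgnb s * PI) with (sgnb s * (PI / 2) + sgnb s * (PI / 2)) by field.
  rewrite cis_add, cis_sgnb_half_pi. unfold Ci. destruct s; cx; ring.
Qed.

Lemma coef_eq N phi lam s x :
  coef (N + 2) (om_of N phi s) (mu_of phi lam s) (sgnb s * x) =
  Copp (Cmul (cis (sgnb s * 2 * phi))
    (Cadd (Cmul (Cpow (Cmul Ci (RtoC x)) (N + 2)) (cis (sgnb s * (INR N + 2) * phi))) lam)).
Proof.
  (* On the half-line [sgnb s * x] is [|x|], so this is the polar form of [i x]; afterwards every
     angle carries the factor [sgnb s]. *)
  replace (Cmul Ci (RtoC x)) with (Cmul (RtoC (sgnb s * x)) (cis (sgnb s * (PI / 2)))).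
  2: { rewrite cis_sgnb_half_pi. assert (h := sgnb_sqr s). unfold Ci; cx; [ring |].
       ring_simplify. replace (sgnb s ^ 2) with 1 by (rewrite <- h; ring). ring. }
  rewrite Cpow_mul, Cpow_RtoC, Cpow_cis, plus_INR. simpl (INR 2).
  unfold coef, om_of, mu_of.
  replace (sgnb s * ((INR N + 4) * (phi + PI / 2)))
    with (sgnb s * PI + (sgnb s * 2 * phi
      + ((INR N + (1 + 1)) * (sgnb s * (PI / 2)) + sgnb s * (INR N + 2) * phi))) by field.
  rewrite (cis_add (sgnb s * PI)), cis_sgnb_pi, (cis_add (sgnb s * 2 * phi)), cis_add.
  ring.
Qed.

Lemma equation_iff N phi lam s x w w2 :
  Cadd (Copp (Cmul (cis (- sgnb s * 2 * phi)) w2))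
       (Copp (Cmul (Cmul (Cpow (Cmul Ci (RtoC x)) (N + 2))
                         (cis (sgnb s * (INR N + 2) * phi))) w)) = Cmul lam w
  <-> w2 = Cmul (coef (N + 2) (om_of N phi s) (mu_of phi lam s) (sgnb s * x)) w.
Proof.
  rewrite coef_eq. set (P := Cmul (Cpow _ _) _).
  assert (h : Cmul (cis (sgnb s * 2 * phi)) (cis (- sgnb s * 2 * phi)) = Cone).
  { rewrite <- cis_add. replace (_ + _) with 0 by ring.
    unfold cis. now rewrite cos_0, sin_0. }
  set (k := cis (sgnb s * 2 * phi)) in *. set (k' := cis (- sgnb s * 2 * phi)) in *.
  split; intros H.
  - transitivity (Cmul (Cmul k k') w2); [rewrite h; ring |].
    transitivity (Copp (Cmul k (Cadd (Cadd (Copp (Cmul k' w2)) (Copp (Cmul P w))) (Cmul P w))));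
      [ring |]. rewrite H. ring.
  - rewrite H.
    transitivity (Cadd (Cmul (Cmul k k') (Cmul (Cadd P lam) w)) (Copp (Cmul P w))); [ring |].
    rewrite h. ring.
Qed.

Lemma is_Cderive_iff f f' x : is_Cderive f x (f' x) <-> has_derivC f f' x.
Proof. unfold is_Cderive, has_derivC. rewrite !is_derive_Reals. tauto. Qed.

Lemma is_derive_scaled f a x l : is_derive f (a * x) l ->
  is_derive (fun t => f (a * t)) x (a * l).
Proof.
  intros h. apply (is_derive_comp f (fun t => a * t)); auto.
  auto_derive; [exact I | ring].
Qed.

Lemma is_Cderive_scaled f a x l : is_Cderive f (a * x) l ->
  is_Cderive (fun t => f (a * t)) x (Cmul (RtoC a) l).
Proof.
  intros [h1 h2]; split; simpl; (eapply is_derive_eqR;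
    [apply (is_derive_scaled (fun t => _ (f t))); eassumption | ring]).
Qed.

Lemma RtoC_sgnb_sqr s z : Cmul (RtoC (sgnb s)) (Cmul (RtoC (sgnb s)) z) = z.
Proof. destruct s; cx; ring. Qed.

Lemma is_solution_reduce N phi lam s w : is_solution N phi lam s w ->
  exists w1, is_sol (N + 2) (om_of N phi s) (mu_of phi lam s) posR
    (fun t => w (sgnb s * t)) w1.
Proof.
  intros [w1 [w2 h]]. exists (fun t => Cmul (RtoC (sgnb s)) (w1 (sgnb s * t))).
  intros t ht. destruct (h _ (half_sgnb s t ht)) as [h1 [h2 h3]].
  apply is_Cderive_iff in h1. apply is_Cderive_iff in h2.
  apply equation_iff in h3. rewrite sgnb_mulK in h3. split.
  - now apply (is_Cderive_scaled w).
  - eapply is_Cderive_eq.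
    + apply is_Cderive_mul; [apply is_Cderive_const | apply (is_Cderive_scaled w1), h2].
    + cbv beta. rewrite RtoC_sgnb_sqr, h3. ring.
Qed.

Lemma is_solution_lift N phi lam s W W1 :
  is_sol (N + 2) (om_of N phi s) (mu_of phi lam s) posR W W1 ->
  is_solution N phi lam s (fun x => W (sgnb s * x)).
Proof.
  intros h. exists (fun x => Cmul (RtoC (sgnb s)) (W1 (sgnb s * x))),
    (fun x => Cmul (coef (N + 2) (om_of N phi s) (mu_of phi lam s) (sgnb s * x))
                (W (sgnb s * x))).
  intros x hx. apply half_posR in hx. destruct (h _ hx) as [h1 h2]. split; [| split].
  - apply is_Cderive_iff. now apply (is_Cderive_scaled W).
  - apply is_Cderive_iff. eapply is_Cderive_eq.
    + apply is_Cderive_mul; [apply is_Cderive_const | apply (is_Cderive_scaled W1), h2].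
    + cbv beta. rewrite RtoC_sgnb_sqr. ring.
  - now apply equation_iff.
Qed.

(** * Square integrability on a half-line and its reflection *)

Lemma half_convex s x y z : half s x -> half s z -> x <= y <= z -> half s y.
Proof. destruct s; simpl; lra. Qed.

Lemma half_open s x : half s x -> locally x (half s).
Proof. destruct s; simpl; intros h; [now apply open_gt | now apply open_lt]. Qed.

(** [L2_half] bounds an integral only where a proof of Riemann integrability exists. Continuity
    supplies one on each compact subinterval, and the fundamental theorem of calculus does the
    rest. *)
Lemma L2_half_iff s w : (forall x, half s x -> continuous (fun t => Cnormsq (w t)) x) ->
  L2_half s w <-> bounded_increments (half s) (fun t => Cnormsq (w t)).
Proof.
  intros hc.
  assert (ftc : forall F a b, (forall x, half s x -> is_derive F x (Cnormsq (w x))) ->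
    half s a -> half s b -> a <= b ->
    is_RInt (fun t => Cnormsq (w t)) a b (F b - F a)).
  { intros F a b hF ha hb hab.
    apply (is_RInt_derive F (fun t => Cnormsq (w t)));
      rewrite Rmin_left, Rmax_right by auto; intros x hx;
      (apply hF || apply hc); eauto using half_convex. }
  split.
  - intros [M hM].
    destruct (antiderivative_exists (half s) (fun t => Cnormsq (w t)) (sgnb s)) as [F hF]; auto.
    + intros x y z. apply half_convex.
    + unfold half, sgnb; destruct s; lra.
    + apply half_open.
    + exists F, M. split; auto. intros a b ha hb hab.
      assert (h := ftc F a b hF ha hb hab).
      assert (pr := ex_RInt_Reals_0 _ _ _ (ex_intro _ _ h)).
      rewrite <- (is_RInt_unique _ _ _ _ h), (RInt_Reals _ _ _ pr). now apply hM.
  - intros [F [M [hF hM]]]. exists M. intros a b pr ha hb hab.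
    rewrite <- RInt_Reals, (is_RInt_unique _ _ _ _ (ftc F a b hF ha hb hab)). now apply hM.
Qed.

(** Reflection reverses the order of endpoints; the outer factor [sgnb s] on the antiderivative
    restores the sign of the increments. *)
Lemma bounded_increments_reflect s f : bounded_increments (half s) f <->
  bounded_increments posR (fun t => f (sgnb s * t)).
Proof.
  split; intros [F [M [hF hM]]]; exists (fun x => sgnb s * F (sgnb s * x)), M; split.
  - intros t ht. eapply is_derive_eqR.
    + apply (is_derive_scal (fun t => F (sgnb s * t))), is_derive_scaled, hF, half_sgnb, ht.
    + apply sgnb_mulK.
  - intros a b ha hb hab. apply (half_sgnb s) in ha, hb. destruct s; simpl in *.
    + specialize (hM _ _ ha hb). lra.
    + specialize (hM _ _ hb ha). lra.
  - intros x hx. eapply is_derive_eqR.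
    + apply (is_derive_scal (fun t => F (sgnb s * t))), is_derive_scaled, hF, half_posR, hx.
    + rewrite !sgnb_mulK. reflexivity.
  - intros a b ha hb hab. apply half_posR in ha, hb. destruct s; simpl in *.
    + specialize (hM _ _ ha hb). lra.
    + specialize (hM _ _ hb ha). lra.
Qed.

Lemma L2_half_reduce N phi lam s w : is_solution N phi lam s w ->
  L2_half s w <-> bounded_increments posR (fun t => Cnormsq (w (sgnb s * t))).
Proof.
  intros [w1 [w2 h]]. rewrite L2_half_iff.
  - apply (bounded_increments_reflect s (fun x => Cnormsq (w x))).
  - intros x hx. destruct (h x hx) as [h1 _]. apply is_Cderive_iff in h1.
    eapply continuous_Cnormsq, h1.
Qed.

Lemma limit_circle_of_om N phi lam s : (1 <= N)%nat -> om_of N phi s = Copp Cone ->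
  limit_circle N phi lam s.
Proof.
  intros hN hom w hw. apply (L2_half_reduce N phi lam s w hw).
  destruct (is_solution_reduce N phi lam s w hw) as [w1 h]. rewrite hom in h.
  destruct (posR_solution_extends _ _ _ _ _ h) as [W [W1 [hW e]]].
  apply bounded_increments_ext with (fun t => Cnormsq (W t)).
  - intros t ht. now rewrite <- e.
  - eapply limit_circle_entire; [| exact hW]. lia.
Qed.

(** [b = (1 + conj om) / |1 + om|] is the conjugate of the square root of [om] in the right
    half-plane. Hence [b om = conj b], and both real parts equal [k (1 + c)]. *)
Lemma half_angle_rotation om : Cnormsq om = 1 -> -1 < fst om ->
  exists b, Cnormsq b = 1 /\ 0 < fst b /\ 0 < fst (Cmul b om).
Proof.
  destruct om as [c s]; unfold Cnormsq; simpl. intros h1 h2.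
  set (k := / sqrt (2 * (1 + c))).
  assert (hs : 0 < sqrt (2 * (1 + c))) by (apply sqrt_lt_R0; lra).
  assert (hk : 0 < k) by (apply Rinv_0_lt_compat, hs).
  assert (hkk : k * k * (2 * (1 + c)) = 1).
  { unfold k. rewrite <- (sqrt_sqrt (2 * (1 + c))) at 3 by lra. field. lra. }
  exists (k * (1 + c), - (k * s)); simpl. split; [| split].
  - replace (k * (1 + c) * (k * (1 + c)) + - (k * s) * - (k * s))
      with (k * k * (1 + 2 * c + (c * c + s * s))) by ring. rewrite h1. lra.
  - apply Rmult_lt_0_compat; lra.
  - replace (k * (1 + c) * c - - (k * s) * s) with (k * (c + (c * c + s * s))) by ring.
    rewrite h1. apply Rmult_lt_0_compat; lra.
Qed.

Lemma limit_point_of_om N phi lam s : -1 < fst (om_of N phi s) -> limit_point N phi lam s.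
Proof.
  intros hom.
  destruct (half_angle_rotation (om_of N phi s)) as [b [hb1 [hb2 hb3]]]; auto.
  { unfold om_of, cis, Cnormsq; simpl. rewrite Rplus_comm. apply sin2_cos2. }
  destruct (limit_point_posR (N + 2) _ (mu_of phi lam s) b ltac:(lia) hb1 hb2 hb3)
    as [W [W1 [hW [hL [[t [ht hnz]] huniq]]]]].
  assert (hsol := is_solution_lift N phi lam s W W1 hW).
  exists (fun x => W (sgnb s * x)). split; [exact hsol |]. split; [| split].
  - apply (L2_half_reduce N phi lam s _ hsol).
    apply bounded_increments_ext with (2 := hL). intros x _. now rewrite sgnb_mulK.
  - exists (sgnb s * t). split; [now apply half_sgnb | now rewrite sgnb_mulK].
  - intros w hw hwL. apply (L2_half_reduce N phi lam s w hw) in hwL.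
    destruct (is_solution_reduce N phi lam s w hw) as [w1 h].
    destruct (huniq _ _ h hwL) as [c hc]. exists c. intros x hx.
    apply half_posR in hx. specialize (hc _ hx). cbv beta in hc.
    now rewrite sgnb_mulK in hc.
Qed.

(** * Stokes lines and wedges *)

Lemma Gamma_cis phi : Gamma phi (cis phi).
Proof.
  exists 1. unfold sgn. destruct (Rlt_dec 0 1); [| lra].
  rewrite Rmult_1_r. unfold cis; cx; ring.
Qed.

Lemma cis_neq0 a : cis a <> C0.
Proof.
  intros h. assert (e := sin2_cos2 a). unfold cis, C0 in h. injection h as h1 h2.
  rewrite h1, h2 in e. unfold Rsqr in e. lra.
Qed.

Lemma cis_polar_eq phi r a : 0 <= r -> cis phi = Cmul (RtoC r) (cis a) -> cis phi = cis a.
Proof.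
  intros hr h. assert (hn := f_equal Cnormsq h). rewrite Cnormsq_mul in hn.
  assert (hc : forall x, Cnormsq (cis x) = 1).
  { intros x. unfold Cnormsq, cis; simpl. rewrite Rplus_comm. apply sin2_cos2. }
  rewrite !hc in hn. unfold Cnormsq, RtoC in hn; simpl in hn.
  assert (r = 1) by nra. subst r. rewrite h. change (RtoC 1) with Cone. ring.
Qed.

(** A point of the plane fixes its angle only modulo [2 PI]. Since [N + 4] is an integer, [om_of] is
    a power of a unit complex number and does not see the ambiguity. *)
Lemma om_of_cis N phi a s : cis phi = cis a -> om_of N phi s = om_of N a s.
Proof.
  intros h.
  assert (h' : cis (phi + PI / 2) = cis (a + PI / 2)) by (now rewrite !cis_add, h).
  assert (hp : cis ((INR N + 4) * (phi + PI / 2)) = cis ((INR N + 4) * (a + PI / 2))).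
  { replace (INR N + 4) with (INR (N + 4)) by (rewrite plus_INR; simpl; ring).
    now rewrite <- !Cpow_cis, h'. }
  unfold om_of. destruct s; simpl.
  - now rewrite !Rmult_1_l.
  - unfold cis in *. injection hp as h1 h2.
    replace (-1 * ((INR N + 4) * (phi + PI / 2))) with (- ((INR N + 4) * (phi + PI / 2))) by ring.
    replace (-1 * ((INR N + 4) * (a + PI / 2))) with (- ((INR N + 4) * (a + PI / 2))) by ring.
    now rewrite !cos_neg, !sin_neg, h1, h2.
Qed.

(** The origin of the Stokes angles: at integer [t] they are the angles whose scaled value is an odd
    multiple of [PI], which is where [om_of] equals [-1]. *)
Lemma scaled_theta N t :
  (INR N + 4) * (theta N t + PI / 2) = PI + 2 * t * PI.
Proof. unfold theta. assert (h := pos_INR N). field. lra. Qed.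

Lemma om_of_Stokes_line N k s : om_of N (theta N (INR k)) s = Copp Cone.
Proof.
  unfold om_of. rewrite scaled_theta. rewrite Rmult_plus_distr_l, cis_add, cis_sgnb_pi.
  replace (cis (sgnb s * (2 * INR k * PI))) with Cone; [ring |].
  assert (h1 : cos (2 * INR k * PI) = 1).
  { rewrite <- (Rplus_0_l (2 * INR k * PI)), cos_period. apply cos_0. }
  assert (h2 : sin (2 * INR k * PI) = 0).
  { rewrite <- (Rplus_0_l (2 * INR k * PI)), sin_period. apply sin_0. }
  unfold cis, Cone. destruct s; simpl.
  - now rewrite Rmult_1_l, h1, h2.
  - replace (-1 * (2 * INR k * PI)) with (- (2 * INR k * PI)) by ring.
    now rewrite cos_neg, sin_neg, h1, h2, Ropp_0.
Qed.

(** Inside a wedge the scaled angle lies strictly between the consecutive odd multiples [(2k-1) PI]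
    and [(2k+1) PI]. After the shift by [2 k PI], half of it has positive cosine, and
    [cos x = 2 cos(x/2)^2 - 1] concludes. *)
Lemma om_of_Stokes_wedge N k a s : theta N (INR k - 1) < a < theta N (INR k) ->
  -1 < fst (om_of N a s).
Proof.
  intros [h1 h2]. assert (hN := pos_INR N).
  apply (Rplus_lt_compat_r (PI / 2)), (Rmult_lt_compat_l (INR N + 4)) in h1, h2; try lra.
  rewrite scaled_theta in h1, h2.
  set (y := (INR N + 4) * (a + PI / 2)) in *.
  replace (fst (om_of N a s)) with (cos y).
  2: { unfold om_of, cis; fold y. destruct s; simpl.
       - now rewrite Rmult_1_l.
       - replace (-1 * y) with (- y) by ring. now rewrite cos_neg. }
  replace y with ((y - 2 * INR k * PI) + 2 * INR k * PI) by ring.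
  rewrite cos_period. set (x := y - 2 * INR k * PI).
  assert (hx : - (PI / 2) < x / 2 < PI / 2) by (unfold x; lra).
  assert (hc := cos_gt_0 (x / 2) (proj1 hx) (proj2 hx)).
  replace x with (2 * (x / 2)) by field. rewrite cos_2a_cos. nra.
Qed.

Theorem theorem2 (N : nat) (phi : R) (hN : (1 <= N)%nat)
  (hphi : - (PI / 2) < phi < PI / 2) :
  ((forall z, Gamma phi z -> z <> C0 ->
      exists k : nat, (k <= N + 3)%nat /\ in_Stokes_wedge N k z) ->
   forall lam : Cx, limit_point N phi lam true /\ limit_point N phi lam false)
  /\
  ((forall z, Gamma phi z ->
      exists k : nat, (k <= N + 3)%nat /\ on_Stokes_line N k z) ->
   forall lam : Cx, limit_circle N phi lam true /\ limit_circle N phi lam false).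
Proof.
  split; intros h lam.
  (* The unit point of the right-hand ray settles both half-lines, because the two values of [om_of]
     are complex conjugates. *)
  - destruct (h (cis phi) (Gamma_cis phi) (cis_neq0 phi)) as [k [_ [r [a [hr [ha e]]]]]].
    apply cis_polar_eq in e; [| lra].
    split; apply limit_point_of_om; rewrite (om_of_cis N phi a _ e);
      now apply om_of_Stokes_wedge with k.
  - destruct (h (cis phi) (Gamma_cis phi)) as [k [_ [r [hr e]]]].
    apply cis_polar_eq in e; [| lra].
    split; apply limit_circle_of_om; auto; rewrite (om_of_cis N phi _ _ e);
      apply om_of_Stokes_line.
Qed.
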